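(* Suppose that $\Lambda\subset\mathbb{N}$ satisfies $\bar d_\Phi(\Lambda)>0$ for some multiplicative Følner sequence $\Phi$. Then $$\liminf_{N\to\infty}\frac{1}{(\log N)^2}\sum_{m,n\in[N]}\frac{1}{mn}\,\bar d_\Phi\big((n^2+n)^{-1}\Lambda\cap(m^2)^{-1}\Lambda\big)>0.$$
   Context: $\mathbb{N}=\{1,2,3,\dots\}$ and $[N]=\{1,\dots,N\}$. A multiplicative Følner sequence in $\mathbb{N}$ is a sequence $\Phi=(\Phi_K)_{K=1}^\infty$ of finite (non-empty) subsets of $\mathbb{N}$ such that for every $x\in\mathbb{N}$, $\lim_{K\to\infty}\frac{|\Phi_K\cap(x\cdot\Phi_K)|}{|\Phi_K|}=1$, where $x\cdot\Phi_K=\{xn: n\in\Phi_K\}$. For $\Lambda\subset\mathbb{N}$, $\bar d_\Phi(\Lambda):=\limsup_{K\to\infty}\frac{|\Phi_K\cap\Lambda|}{|\Phi_K|}$. For $x\in\mathbb{N}$, $x^{-1}\Lambda:=\{k\in\mathbb{N}: xk\in\Lambda\}$. *)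

(* Defs.v *)
From HB Require Import structures.
From mathcomp Require Import all_boot all_order all_algebra.
From mathcomp Require Import finmap.
From mathcomp Require Import all_classical all_reals all_analysis.

Set Implicit Arguments.
Unset Strict Implicit.
Unset Printing Implicit Defensive.

Import Order.TTheory GRing.Theory Num.Theory.
Import numFieldNormedType.Exports.

Local Open Scope fset_scope.
Local Open Scope classical_set_scope.
Local Open Scope ring_scope.

(* The natural numbers of the text start at 1, whereas [nat] contains 0:
   positivity is therefore stated explicitly for the elements of the sets
   involved.  Sequences indexed by K >= 1 become [nat]-indexed ones, which only
   relabels the terms. *)

Definition dilate (x : nat) (A : {fset nat}) : {fset nat} :=
  [fset (x * n)%N | n in A]%fset.

Definition inv_dilate (x : nat) (L : set nat) : set nat :=
  [set k | (0 < k)%N /\ L (x * k)%N].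

Definition mult_Folner (R : realType) (Phi : nat -> {fset nat}) : Prop :=
  [/\ forall K, Phi K != fset0,
      forall K n, n \in Phi K -> (0 < n)%N &
      forall x, (0 < x)%N ->
        (#|` (Phi K `&` dilate x (Phi K))%fset|%:R / #|` Phi K|%:R : R)
          @[K --> \oo] --> (1 : R)].

Definition upper_density (R : realType) (Phi : nat -> {fset nat})
    (L : set nat) : \bar R :=
  limn_esup (fun K =>
    (#|` [fset k in Phi K | k \in L]%fset|%:R / #|` Phi K|%:R : R)%:E).

Arguments mult_Folner : clear implicits.
Arguments upper_density : clear implicits.

(* Main.v *)
Require Import Defs.
From mathcomp Require Import all_boot all_order all_algebra.
From mathcomp Require Import finmap.
From mathcomp Require Import all_classical all_reals all_analysis.
From mathcomp Require Import ring lra zify.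
Import Order.TTheory GRing.Theory Num.Theory.
Import numFieldNormedType.Exports.
Set Implicit Arguments.
Unset Strict Implicit.
Unset Printing Implicit Defensive.
Local Open Scope classical_set_scope.
Local Open Scope ring_scope.

(** Passing to an ultrafilter limit of the averages over the Folner sets turns
    the densities of [A^-1 L] meet [B^-1 L] into a positive definite kernel
    [rho A B] that is invariant under common dilation, with [rho 1 1 = delta]
    and [rho A B] at most the upper density of the intersection.  Let [T_x] be
    dilation by [x], so that [<T_x a, T_y a> = rho x y] for [a] the indicator of
    [L], put [U_n = T_(n^2)], and let [B] average [U_r] over random products [r]
    of distinct primes in [(w, y]], weighted by [r^-(1+s)].  These averages
    factor over primes, so the energy [|B a|^2] decreases with [y] and [1/s] and
    increases with [w]; choosing [w] with almost extremal energy forces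
    [|B a|^2 - |B B a|^2] to be small: on the part of [a] that [B] does not
    kill, [U_r] acts almost like a constant for typical [r].

    Choose [c_0 < ... < c_(k-1)] with [c_j - c_i] dividing [c_i], and a multiple
    [M] of all the [c_i].  With [x_i = t M + c_i] and [n = x_i / (c_j - c_i)] one
    has [n + 1 = x_j / (c_j - c_i)].  Let [n_r] be the part of [n] made of primes
    in [(w, y]], [n_s = n / n_r] and [m = n_s r]; then [(n^2 + n) / m^2] equals
    [x_j n_r^2 / (x_i r^2)], so averaging over [r] and [t] replaces the
    correlation of [n^2 + n] and [m^2] by [<T_(x_j) B a, T_(x_i) B a>].  As soon
    as [k delta >= 2], Cauchy-Schwarz makes the sum of these over [i < j] at
    least 1.  The pairs [(n, m)] met this way have bounded density with respect
    to the weight [1 / (n m (log N)^2)] when [s] is a multiple of [1 / log N]. *)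

(** * The kernel of a Folner sequence *)

(** The limit is the supremum of the levels that [u] reaches on a set of [U]; maximality of [U] puts
    the complement of every higher level in [U]. *)
Lemma ultra_cvg (R : realType) (U : set_system nat) (u : nat -> R) (a b : R) :
  UltraFilter U -> (forall K, a <= u K <= b) -> cvg (u @ U).
Proof.
move=> UF ub.
pose S := [set x | U [set K | x <= u K]].
have Sa : S a by apply: filterE => K /=; case/andP: (ub K).
have Sb : ubound S b.
  move=> x Sx; have [K /= xK] := filter_ex Sx.
  by apply: le_trans xK _; case/andP: (ub K).
have supS : has_sup S by split; [exists a | exists b].
apply/cvg_ex; exists (sup S); apply/cvgrPdist_le => e e0.
have [x Sx xe] := sup_adherent e0 supS.
have : U (~` [set K | sup S + e <= u K]).
  have [h|//] := in_ultra_setVsetC [set K | sup S + e <= u K] UF.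
  have := ub_le_sup supS.2 h; lra.
apply: filterS2 Sx => K /= h1 /negP; rewrite -ltNge => h2.
by rewrite ler_distlC; apply/andP; split; lra.
Qed.

Lemma cvg_sum_seq (R : realType) (F : set_system nat) (FF : Filter F)
    (I : eqType) (r : seq I) (u : I -> nat -> R) (l : I -> R) :
  (forall i, i \in r -> u i @ F --> l i) ->
  (\sum_(i <- r) u i K) @[K --> F] --> \sum_(i <- r) l i.
Proof.
elim: r => [|i r IH] H.
  by rewrite big_nil; under eq_fun do rewrite big_nil; exact: cvg_cst.
rewrite big_cons; under eq_fun do rewrite big_cons.
apply: cvgD; first by apply: H; rewrite inE eqxx.
by apply: IH => j jr; apply: H; rewrite inE jr orbT.
Qed.

(* The sum on the left of [kernel_psd] omits [i = 0]: for the kernel of a set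
   of positive integers, [rho 0 j = 0] while [rho i i = delta] for [i > 0]. *)
Record dilation_kernel (R : realType) (delta : R) (rho : nat -> nat -> R) : Prop :=
  DilationKernel {
    kernel_sym : forall i j, rho i j = rho j i;
    kernel_ge0 : forall i j, 0 <= rho i j;
    kernel_le1 : forall i j, rho i j <= 1;
    kernel_dil : forall c i j, (0 < c)%N -> rho (c * i)%N (c * j)%N = rho i j;
    kernel_diag : rho 1%N 1%N = delta;
    kernel_psd : forall n (c : nat -> R),
      delta ^+ 2 * (\sum_(1 <= i < n) c i) ^+ 2 <=
      \sum_(i < n) \sum_(j < n) c i * c j * rho i j }.

Section Correspondence.
Context (R : realType) (Phi : nat -> {fset nat}) (L : set nat).
Hypothesis hPhi : mult_Folner R Phi.
Hypothesis hL : L `<=` [set n | (0 < n)%N].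

Let avg (h : nat -> R) (K : nat) : R :=
  (\sum_(k <- Phi K) h k) / #|` Phi K|%:R.

Let cardPhi_gt0 K : 0 < #|` Phi K|%:R :> R.
Proof. by have [P0 _ _] := hPhi; rewrite ltr0n cardfs_gt0. Qed.

Let avg_bound (h : nat -> R) K : (forall k, 0 <= h k <= 1) -> 0 <= avg h K <= 1.
Proof.
move=> h01; apply/andP; split.
  by apply: divr_ge0 => //; apply: sumr_ge0 => k _; case/andP: (h01 k).
rewrite ler_pdivrMr // mul1r card_fset_sum1 natr_sum.
by apply: ler_sum => k _; case/andP: (h01 k).
Qed.

(** After the substitution of [x * k] the two sums differ only over [Phi K] minus its dilate and the
    dilate minus [Phi K]. These have equal size, a proportion of [Phi K] that the Folner condition
    sends to 0. *)
Let avg_dilate (h : nat -> R) x : (0 < x)%N -> (forall k, 0 <= h k <= 1) ->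
  (avg (fun k => h (x * k)%N) K - avg h K) @[K --> \oo] --> (0 : R).
Proof.
move=> x0 h01.
have [_ _ /(_ x x0) F] := hPhi.
have cI K : #|` (Phi K `&` dilate x (Phi K))%fset|%:R / #|` Phi K|%:R <= 1 :> R.
  by rewrite ler_pdivrMr // mul1r ler_nat; apply: fsubset_leq_card; apply: fsubsetIl.
have key K : `|avg (fun k => h (x * k)%N) K - avg h K| <=
  1 - #|` (Phi K `&` dilate x (Phi K))%fset|%:R / #|` Phi K|%:R.
  have e : \sum_(k <- Phi K) h (x * k)%N = \sum_(k <- dilate x (Phi K)) h k.
    rewrite /dilate big_imfset //= => i j _ _ /eqP.
    by rewrite eqn_pmul2l // => /eqP.
  have cD : #|` dilate x (Phi K)| = #|` Phi K|.
    by rewrite card_imfset // => i j /eqP; rewrite eqn_pmul2l // => /eqP.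
  set A := Phi K; set B := dilate x A in e cD *.
  have bd (C D : {fset nat}) : 0 <= \sum_(k <- (C `\` D)%fset) h k <=
      #|` C|%:R - #|` (C `&` D)%fset|%:R.
    apply/andP; split; first by apply: sumr_ge0 => k _; case/andP: (h01 k).
    rewrite -(cardfsID D C) natrD addrAC subrr add0r card_fset_sum1 natr_sum.
    by apply: ler_sum => k _; case/andP: (h01 k).
  have sp (C D : {fset nat}) : \sum_(k <- C) h k =
      \sum_(k <- (C `&` D)%fset) h k + \sum_(k <- (C `\` D)%fset) h k.
    rewrite (big_fsetID _ (mem D)) /=; congr (_ + _); apply: eq_fbigl => i;
    by rewrite !inE //= andbC.
  have /andP[a1 a2] := bd A B; have /andP[b1 b2] := bd B A.
  rewrite /avg e -/A -mulrBl normrM (sp A B) (sp B A) fsetIC.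
  rewrite fsetIC cD in b2.
  rewrite [X in _ * X <= _]ger0_norm ?invr_ge0 //.
  rewrite ler_pdivrMr ?cardPhi_gt0 // mulrBl mul1r.
  rewrite divfK ?gt_eqF ?cardPhi_gt0 //.
  set I := \sum_(k <- (_ `&` _)%fset) _; rewrite opprD addrACA subrr add0r.
  rewrite -/A in b2; rewrite ler_norml; apply/andP; split; lra.
apply: norm_cvg0.
apply: (@squeeze_cvgr _ _ _ _ (cst 0)
  (fun K => 1 - #|` (Phi K `&` dilate x (Phi K))%fset|%:R / #|` Phi K|%:R)).
- by apply: nearW => K; rewrite normr_ge0 key.
- exact: cvg_cst.
- rewrite -(subrr (1 : R)); apply: cvgB => //; exact: cvg_cst.
Qed.

Let avg_ind (S : set nat) (f : nat -> R) K :
  (forall k, k \in Phi K -> f k = (k \in S)%:R) ->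
  avg f K = #|` [fset k in Phi K | k \in S]%fset|%:R / #|` Phi K|%:R.
Proof.
move=> fS; rewrite /avg; congr (_ / _).
rewrite card_fset_sum1 natr_sum big_fset /= [RHS]big_mkcond /=.
rewrite big_seq [RHS]big_seq; apply: eq_bigr => k kP.
by rewrite fS //; case: (k \in S).
Qed.

Lemma dilation_kernel_exists : (0 < upper_density R Phi L)%E ->
  exists delta rho, [/\ (0 < delta :> R), dilation_kernel delta rho &
    forall A B, ((rho A B)%:E <=
      upper_density R Phi (inv_dilate A L `&` inv_dilate B L))%E].
Proof.
move=> hd.
pose a k : R := (k \in L)%:R.
pose h A B k := a (A * k)%N * a (B * k)%N.
have a01 k : 0 <= a k <= 1 by rewrite /a; case: (_ \in _) => /=; lra.
have h01 A B k : 0 <= h A B k <= 1.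
  by rewrite /h /a; do 2!case: (_ \in _) => /=; lra.
have hE A B K : avg (h A B) K = #|` [fset k in Phi K |
    k \in (inv_dilate A L `&` inv_dilate B L)%classic]%fset|%:R / #|` Phi K|%:R.
  apply: avg_ind => k kP; rewrite /h /a -natrM mulnb; congr (nat_of_bool _)%:R.
  have [_ /(_ K k kP) k0 _] := hPhi.
  apply/andP/idP; rewrite !in_setE; first by move=> -[].
  by move=> [[_ ?] [_ ?]].
have [d0 d0_gt0 d0_lt] : exists2 d0 : R, 0 < d0 & (d0%:E < upper_density R Phi L)%E.
  case: (upper_density R Phi L) hd => [r| |] //=.
    by rewrite lte_fin => r0; exists (r / 2); rewrite ?lte_fin; lra.
  by exists 1; rewrite ?ltry.
have aE K : avg a K = #|` [fset k in Phi K | k \in L]%fset|%:R / #|` Phi K|%:R.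
  exact: avg_ind.
have freq n : exists2 K, (n <= K)%N & d0 <= avg a K.
  have : (d0%:E < ereal_sup ((fun K => (avg a K)%:E) @` [set K | (n <= K)%N]))%E.
    apply: lt_le_trans d0_lt _; rewrite /upper_density /limn_esup limf_esupE.
    apply: ereal_inf_lbound; exists [set K | (n <= K)%N]; first exact: nbhs_infty_ge.
    by congr ereal_sup; apply: eq_imagel => K _ /=; rewrite aE.
  move=> /ereal_sup_gt [_ [K /= nK <-]]; rewrite lte_fin => /ltW dK.
  by exists K.
(* Any ultrafilter finer than [F] contains the set of [K] where [a] has average at least [d0], which
   keeps [delta] positive; [freq] makes [F] proper. *)
pose F := within [set K | d0 <= avg a K] \oo.
have FP : ProperFilter F.
  apply: Build_ProperFilter_ex => P [n _ nP].
  by have [K nK dK] := freq n; exists K; apply: (nP K nK).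
have [U [UU FU]] := ultraFilterLemma FP.
have ooU : \oo `<=` U by apply: subset_trans FU; apply: cvg_within.
pose delta := lim (avg a @ U).
pose rho A B := lim (avg (h A B) @ U).
have ca : avg a @ U --> delta.
  by apply: (ultra_cvg (a := 0) (b := 1)) => K; apply: avg_bound.
have ch A B : avg (h A B) @ U --> rho A B.
  by apply: (ultra_cvg (a := 0) (b := 1)) => K; apply: avg_bound.
have dilU g x : (0 < x)%N -> (forall k, 0 <= g k <= 1) ->
    (avg (fun k => g (x * k)%N) K - avg g K) @[K --> U] --> (0 : R).
  by move=> x0 g01; apply: cvg_trans (avg_dilate x0 g01); apply: cvg_app.
have cd i : (0 < i)%N -> avg (fun k => a (i * k)%N) @ U --> delta.
  move=> i0; rewrite -[delta]add0r.
  refine (cvg_trans _ (cvgD (dilU a i i0 a01) ca)).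
  by apply: near_eq_cvg; apply: nearW => K; rewrite /= !fctE subrK.
exists delta, rho; split.
- apply: lt_le_trans d0_gt0 _; apply: limr_ge; first by apply/cvg_ex; exists delta.
  by apply: FU; apply: withinT.
- split.
  + by move=> i j; rewrite /rho; congr (lim (avg _ @ U)); apply/funext => k; rewrite /h mulrC.
  + move=> i j; apply: limr_ge; first by apply/cvg_ex; exists (rho i j).
    by apply: nearW => K; case/andP: (avg_bound K (h01 i j)).
  + move=> i j; apply: limr_le; first by apply/cvg_ex; exists (rho i j).
    by apply: nearW => K; case/andP: (avg_bound K (h01 i j)).
  + move=> c i j c0; apply: (cvg_lim (@Rhausdorff R)).
    rewrite -[rho i j]add0r.
    refine (cvg_trans _ (cvgD (dilU (h i j) c c0 (h01 i j)) (ch i j))).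
    apply: near_eq_cvg; apply: nearW => K; rewrite /= !fctE subrK.
    by congr avg; apply/funext => k; rewrite /h -!mulnA ![(c * (_ * _))%N]mulnCA.
  + rewrite /rho; congr (lim (avg _ @ U)); apply/funext => k.
    by rewrite /h mul1n /a -natrM mulnb andbb.
  + move=> n c.
    pose f k := \sum_(1 <= i < n) c i * a (i * k)%N.
    have a0 : a 0%N = 0.
      by rewrite /a memNset //= => /hL /=; rewrite ltnn.
    (* Index 0 contributes nothing to [f], as 0 is not in [L]; hence the coefficient sum may start
       at 1 while the quadratic form starts at 0. *)
    have fE k : f k = \sum_(i < n) c i * a (i * k)%N.
      rewrite /f -(big_mkord xpredT (fun i => c i * a (i * k)%N)).
      case: (n) => [|n']; first by rewrite !big_geq.
      by rewrite [RHS]big_nat_recl // mul0n a0 mulr0 add0r big_add1.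
    have cf : avg f @ U --> delta * \sum_(1 <= i < n) c i.
      have -> : avg f = (fun K => \sum_(1 <= i < n) c i * avg (fun k => a (i * k)%N) K).
        apply/funext => K; rewrite /avg /f exchange_big /= mulr_suml.
        by apply: eq_bigr => i _; rewrite mulrA mulr_sumr.
      rewrite mulr_sumr; apply: cvg_sum_seq => i; rewrite mem_index_iota => /andP[i0 _].
      by rewrite mulrC; apply: cvgMl_tmp; apply: cd.
    have cf2 : avg (fun k => f k ^+ 2) @ U --> \sum_(i < n) \sum_(j < n) c i * c j * rho i j.
      have -> : avg (fun k => f k ^+ 2) =
          (fun K => \sum_(i < n) \sum_(j < n) c i * c j * avg (h i j) K).
        apply/funext => K; rewrite /avg; under eq_bigr do rewrite fE expr2 mulr_suml.
        rewrite exchange_big mulr_suml; apply: eq_bigr => i _ /=.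
        under eq_bigr do rewrite mulr_sumr.
        rewrite exchange_big mulr_suml; apply: eq_bigr => j _ /=.
        rewrite mulrA mulr_sumr; congr (_ / _); apply: eq_bigr => k _.
        by rewrite /h mulrACA.
      by apply: cvg_sum_seq => i _; apply: cvg_sum_seq => j _; apply: cvgMl_tmp.
    (* The variance of [f] over [Phi K] is nonnegative; this passes to the limit along [U]. *)
    rewrite -exprMn; apply: (ler_cvg_to (cvgM cf cf) cf2); apply: nearW => K /=.
    rewrite /=; set m := avg f K.
    have : 0 <= avg (fun k => (f k - m) ^+ 2) K.
      by apply: divr_ge0 => //; apply: sumr_ge0 => k _; apply: sqr_ge0.
    have mE : \sum_(k <- Phi K) f k = m * #|` Phi K|%:R.
      by rewrite /m /avg divfK ?gt_eqF.
    suff -> : avg (fun k => (f k - m) ^+ 2) K = avg (fun k => f k ^+ 2) K - m * m by lra.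
    have -> : m * m = (m * m * #|` Phi K|%:R) / #|` Phi K|%:R by rewrite mulfK ?gt_eqF.
    rewrite /avg -mulrBl; congr (_ / _).
    have -> : \sum_(k <- Phi K) (f k - m) ^+ 2 =
        \sum_(k <- Phi K) (f k ^+ 2 + (- (2 * m)) * f k + m ^+ 2 * 1).
      by apply: eq_bigr => k _; ring.
    rewrite !big_split /= -!mulr_sumr mE -(natr_sum _ (Phi K) xpredT (fun=> 1%N)) -card_fset_sum1.
    by ring.
- move=> A B.
  (* [U] contains every set [V] that contains a tail, so the limit along [U] is at most the supremum
     over [V]. *)
  rewrite /upper_density /limn_esup limf_esupE; apply: le_ereal_inf_tmp => _ [V Voo <-].
  have cE : (avg (h A B) K)%:E @[K --> U] --> (rho A B)%:E.
    by apply: cvg_EFin (ch A B); apply: nearW.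
  rewrite -(cvg_lim (@ereal_hausdorff R) cE); apply: lime_le.
    by apply/cvg_ex; exists (rho A B)%:E.
  apply: ooU; apply: filterS Voo => K VK.
  by apply: ereal_sup_ubound; exists K => //; rewrite hE.
Qed.
End Correspondence.

(** * Dilation operators and their averages *)

(* Vectors are finite formal combinations of the dilates of one function [a]:
   the monomial ['X^x] stands for [k |-> a (x * k)]. *)
Definition dil (R : realType) (x : nat) (v : {poly R}) : {poly R} := v \Po 'X^x.

(** The expectation of a dilation by [p ^ 2] performed with probability [al p]; composing over a
    list of distinct primes makes these choices independent. *)
Definition bern (R : realType) (al : nat -> R) (p : nat) (v : {poly R}) : {poly R} :=
  (1 - al p) *: v + al p *: dil (p ^ 2) v.

Definition bernl (R : realType) (al : nat -> R) (l : seq nat) (v : {poly R}) :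
  {poly R} := foldr (bern al) v l.

Section DilationOperators.
Context {R : realType}.
Implicit Types (u v : {poly R}) (al be : nat -> R) (l : seq nat).

Lemma dilD x u v : dil x (u + v) = dil x u + dil x v.
Proof. exact: comp_polyD. Qed.

Lemma dilZ x (c : R) v : dil x (c *: v) = c *: dil x v.
Proof. exact: comp_polyZ. Qed.

Lemma dil_sum x (I : Type) (r : seq I) (P : pred I) (F : I -> {poly R}) :
  dil x (\sum_(i <- r | P i) F i) = \sum_(i <- r | P i) dil x (F i).
Proof. exact: raddf_sum. Qed.

Lemma dilXn x i : dil x 'X^i = 'X^(x * i) :> {poly R}.
Proof. by rewrite /dil comp_Xn_poly exprM. Qed.

Lemma dil1 v : dil 1 v = v.
Proof. by rewrite /dil expr1 comp_polyXr. Qed.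

Lemma dil_dil x y v : dil x (dil y v) = dil (x * y) v.
Proof. by rewrite /dil -comp_polyA comp_Xn_poly exprM. Qed.

Lemma dilC x y v : dil x (dil y v) = dil y (dil x v).
Proof. by rewrite !dil_dil mulnC. Qed.

Lemma horner_dil x v c : (dil x v).[c] = v.[c ^+ x].
Proof. by rewrite /dil horner_comp hornerXn. Qed.

Lemma dil_bern x al p v : dil x (bern al p v) = bern al p (dil x v).
Proof. by rewrite /bern dilD !dilZ dilC. Qed.

Lemma dil_bernl x al l v : dil x (bernl al l v) = bernl al l (dil x v).
Proof. by elim: l => //= p l IH; rewrite dil_bern IH. Qed.

Lemma bernD al p u v : bern al p (u + v) = bern al p u + bern al p v.
Proof. by rewrite /bern dilD !scalerDr addrACA. Qed.

Lemma bernZ al p c v : bern al p (c *: v) = c *: bern al p v.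
Proof. by rewrite /bern dilZ scalerDr !scalerA ![c * _]mulrC. Qed.

Lemma bernlD al l u v : bernl al l (u + v) = bernl al l u + bernl al l v.
Proof. by elim: l => //= p l ->; rewrite bernD. Qed.

Lemma bernlZ al l c v : bernl al l (c *: v) = c *: bernl al l v.
Proof. by elim: l => //= p l ->; rewrite bernZ. Qed.

Lemma bernlB al l u v : bernl al l (u - v) = bernl al l u - bernl al l v.
Proof. by rewrite -scaleN1r bernlD bernlZ scaleN1r. Qed.

Lemma bern_bernl be p al l v :
  bern be p (bernl al l v) = bernl al l (bern be p v).
Proof. by rewrite /bern dil_bernl bernlD !bernlZ. Qed.

Lemma bernlC al l be l' v :
  bernl al l (bernl be l' v) = bernl be l' (bernl al l v).
Proof. by elim: l' => //= p l' IH; rewrite -IH -bern_bernl. Qed.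

Lemma bernl_cat al l l' v : bernl al (l ++ l') v = bernl al l (bernl al l' v).
Proof. exact: foldr_cat. Qed.

(** Meant for [c = 0] and [c = 1], where a polynomial takes its constant coefficient and its
    coefficient sum: these points are fixed by all positive powers, so averaging dilates preserves
    both. *)
Lemma horner_bernl al l v c : (forall n, (0 < n)%N -> c ^+ n = c) ->
  {in l, forall p, (0 < p)%N} -> (bernl al l v).[c] = v.[c].
Proof.
move=> hc; elim: l => //= p l IH H.
have p0 := H p (mem_head _ _).
rewrite /bern hornerD !hornerZ horner_dil hc ?expn_gt0 ?p0 // IH; first ring.
by move=> q ql; apply: H; rewrite inE ql orbT.
Qed.
End DilationOperators.

(** * The inner product defined by the kernel *)

Section InnerProduct.
Context (R : realType) (delta : R) (rho : nat -> nat -> R).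
Hypothesis K : dilation_kernel delta rho.
Implicit Types (u v : {poly R}) (al be : nat -> R) (l : seq nat).

(** Bilinear extension of [rho] from monomials; for the kernel of a set it is the limiting mean of
    the product of the functions that [u] and [v] stand for. *)
Definition ip u v : R :=
  \sum_(i < size u) \sum_(j < size v) u`_i * v`_j * rho i j.

Notation nrm v := (ip v v).

Let lin_wide (F : nat -> R) u n : (size u <= n)%N ->
  \sum_(i < size u) u`_i * F i = \sum_(i < n) u`_i * F i.
Proof.
move=> un; rewrite (big_ord_widen n (fun i => u`_i * F i) un) big_mkcond /=.
by apply: eq_bigr => i _; case: ltnP => // h; rewrite nth_default // mul0r.
Qed.

Lemma ip_wide n u v : (size u <= n)%N -> (size v <= n)%N ->
  ip u v = \sum_(i < n) \sum_(j < n) u`_i * v`_j * rho i j.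
Proof.
move=> un vn; rewrite /ip.
have H (w : {poly R}) m : (size w <= m)%N -> forall i,
    \sum_(j < size w) u`_i * w`_j * rho i j = u`_i * \sum_(j < m) w`_j * rho i j.
  move=> wm i; rewrite -(lin_wide (rho i) wm) mulr_sumr.
  by apply: eq_bigr => j _; rewrite mulrA.
under eq_bigr do rewrite (H v n vn).
rewrite (lin_wide (fun i => \sum_(j < n) v`_j * rho i j) un).
by apply: eq_bigr => i _; rewrite mulr_sumr; apply: eq_bigr => j _; rewrite mulrA.
Qed.

Lemma ipC u v : ip u v = ip v u.
Proof.
rewrite /ip exchange_big; apply: eq_bigr => i _; apply: eq_bigr => j _.
by rewrite (kernel_sym K) [u`_j * _]mulrC.
Qed.

Lemma ipDl u v w : ip (u + v) w = ip u w + ip v w.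
Proof.
pose n := maxn (size u) (maxn (size v) (size w)).
have un : (size u <= n)%N by rewrite leq_maxl.
have vn : (size v <= n)%N by rewrite /n maxnCA leq_maxl.
have wn : (size w <= n)%N by rewrite /n maxnA leq_maxr.
have uvn : (size (u + v)%R <= n)%N.
  by apply: leq_trans (size_polyD _ _) _; rewrite geq_max un vn.
rewrite !(@ip_wide n) // -big_split; apply: eq_bigr => i _ /=.
by rewrite -big_split; apply: eq_bigr => j _ /=; rewrite coefD; ring.
Qed.

Lemma ipZl c u v : ip (c *: u) v = c * ip u v.
Proof.
pose n := maxn (size u) (size v).
have un : (size u <= n)%N by rewrite leq_maxl.
have vn : (size v <= n)%N by rewrite leq_maxr.
have cun : (size (c *: u)%R <= n)%N by apply: leq_trans (size_scale_leq _ _) _.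
rewrite !(@ip_wide n) // mulr_sumr; apply: eq_bigr => i _ /=.
by rewrite mulr_sumr; apply: eq_bigr => j _ /=; rewrite coefZ; ring.
Qed.

Lemma ipDr u v w : ip w (u + v) = ip w u + ip w v.
Proof. by rewrite ipC ipDl !(ipC w). Qed.

Lemma ipZr c u v : ip u (c *: v) = c * ip u v.
Proof. by rewrite ipC ipZl ipC. Qed.

Lemma ipBl u v w : ip (u - v) w = ip u w - ip v w.
Proof. by rewrite ipDl -scaleN1r ipZl mulN1r. Qed.

Lemma ipBr u v w : ip w (u - v) = ip w u - ip w v.
Proof. by rewrite ipDr -scaleN1r ipZr mulN1r. Qed.

Lemma ip0l v : ip 0 v = 0.
Proof. by rewrite -(scale0r v) ipZl mul0r. Qed.

Lemma ip_suml (I : Type) (r : seq I) (F : I -> {poly R}) v :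
  ip (\sum_(i <- r) F i) v = \sum_(i <- r) ip (F i) v.
Proof.
elim: r => [|i r IH]; first by rewrite !big_nil ip0l.
by rewrite !big_cons ipDl IH.
Qed.

Lemma ip_sumr (I : Type) (r : seq I) (F : I -> {poly R}) v :
  ip v (\sum_(i <- r) F i) = \sum_(i <- r) ip v (F i).
Proof. by rewrite ipC ip_suml; apply: eq_bigr => i _; rewrite ipC. Qed.

Lemma ipXn i j : ip 'X^i 'X^j = rho i j.
Proof.
have E k n : (k < n)%N -> forall F : nat -> R, \sum_(m < n) ('X^k)`_m * F m = F k.
  move=> kn F; rewrite (bigD1 (Ordinal kn)) //= coefXn eqxx mul1r big1 ?addr0 //.
  move=> m; rewrite -val_eqE /= coefXn => /negPf ->; exact: mul0r.
pose n := maxn i.+1 j.+1.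
have ni : (size ('X^i : {poly R})%R <= n)%N by rewrite size_polyXn leq_maxl.
have nj : (size ('X^j : {poly R})%R <= n)%N by rewrite size_polyXn leq_maxr.
rewrite (ip_wide ni nj).
under eq_bigr => a _.
  under eq_bigr do rewrite -mulrA.
  rewrite -mulr_sumr E ?leq_maxr //; over.
by rewrite (E i n _ (rho^~ j)) // leq_maxl.
Qed.

Lemma ip_dil x u v : (0 < x)%N -> ip (dil x u) (dil x v) = ip u v.
Proof.
move=> x0; rewrite -[u]coefK -[v]coefK !poly_def !dil_sum !ip_suml.
apply: eq_bigr => i _; rewrite !ip_sumr; apply: eq_bigr => j _.
by rewrite !dilZ !dilXn !ipZl !ipZr !ipXn (kernel_dil K).
Qed.

(** Cauchy-Schwarz against constants: a monomial of positive degree stands for a function of mean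
    [delta], so [v] has mean [delta * v.[1]]. *)
Lemma ip_mean v : v.[0] = 0 -> delta ^+ 2 * v.[1] ^+ 2 <= nrm v.
Proof.
move=> v0; apply: le_trans (kernel_psd K (size v) (fun i => v`_i)).
rewrite horner_coef; under eq_bigr do rewrite expr1n mulr1.
rewrite -(big_mkord xpredT (fun i => v`_i)).
case: (posnP (size v)) => [->|vs]; first by rewrite !big_geq.
by rewrite big_ltn // -horner_coef0 v0 add0r.
Qed.

Lemma nrm_ge0 v : 0 <= nrm v.
Proof.
apply: le_trans (kernel_psd K (size v) (fun i => v`_i)).
by rewrite mulr_ge0 ?sqr_ge0.
Qed.

Lemma nrm_dil x v : (0 < x)%N -> nrm (dil x v) = nrm v.
Proof. exact: ip_dil. Qed.

(** Expand [|u + eta v|^2 >= 0] and divide by [2 eta]. *)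
Lemma ip_lower (eta : R) u v : 0 < eta ->
  - (eta / 2 * nrm v + nrm u / (2 * eta)) <= ip u v.
Proof.
move=> e0; have := nrm_ge0 (u + eta *: v).
rewrite !(ipDl, ipDr, ipZl, ipZr) (ipC v u) => H.
have -> : ip u v = (2 * eta)^-1 * (2 * eta * ip u v) by field; rewrite gt_eqF.
have -> : - (eta / 2 * nrm v + nrm u / (2 * eta)) =
  (2 * eta)^-1 * - (eta * (eta * nrm v) + nrm u) by field; rewrite gt_eqF.
by rewrite ler_pM2l ?invr_gt0; lra.
Qed.

(** The dilation is an isometry, so the energy lost is the variance of a two-point average of [v]
    and its dilate. *)
Lemma nrm_bern al p v : (0 < p)%N ->
  nrm (bern al p v) = nrm v - al p * (1 - al p) * nrm (v - dil (p ^ 2) v).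
Proof.
move=> p0; rewrite /bern !(ipBl, ipBr, ipDl, ipDr, ipZl, ipZr).
rewrite nrm_dil ?expn_gt0 ?p0 // (ipC (dil _ v) v); ring.
Qed.

Lemma nrm_bern_le al p v : (0 < p)%N -> 0 <= al p <= 1 ->
  nrm (bern al p v) <= nrm v.
Proof.
move=> p0 /andP[a0 a1]; rewrite nrm_bern // gerBl mulr_ge0 ?nrm_ge0 //.
by rewrite mulr_ge0 // subr_ge0.
Qed.

Lemma nrm_bernl_le al l v : {in l, forall p, (0 < p)%N /\ 0 <= al p <= 1} ->
  nrm (bernl al l v) <= nrm v.
Proof.
elim: l => //= p l IH H; have [p0 ap] := H p (mem_head _ _).
apply: le_trans (nrm_bern_le _ p0 ap) (IH _) => q ql.
by apply: H; rewrite inE ql orbT.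
Qed.

(** By [nrm_bern] the loss at one prime grows with [al p * (1 - al p)]; the operators commute, so
    the primes are exchanged one at a time. *)
Lemma nrm_bernl_mono al be l v :
  {in l, forall p, (0 < p)%N /\ al p * (1 - al p) <= be p * (1 - be p)} ->
  nrm (bernl be l v) <= nrm (bernl al l v).
Proof.
elim: l v => //= p l IH v H; have [p0 ap] := H p (mem_head _ _).
apply: (@le_trans _ _ (nrm (bern al p (bernl be l v)))).
  by rewrite !nrm_bern // lerD2l lerN2 ler_wpM2r ?nrm_ge0.
rewrite !bern_bernl; apply: IH => q ql; apply: H.
by rewrite inE ql orbT.
Qed.

(* The defect [|v|^2 - |A v|^2] of a contraction [A] commuting with the
   dilations is a dilation-invariant convex function of [v]. *)
Lemma bernl_defect al l be l' v :
  {in l, forall p, (0 < p)%N /\ 0 <= al p <= 1} ->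
  {in l', forall p, (0 < p)%N /\ 0 <= be p <= 1} ->
  nrm (bernl be l' v) - nrm (bernl al l (bernl be l' v)) <=
  nrm v - nrm (bernl al l v).
Proof.
move=> hl; elim: l' => //= p l' IH H; have [p0 /andP[b0 b1]] := H p (mem_head _ _).
apply: le_trans (IH _); last by move=> q ql; apply: H; rewrite inE ql orbT.
rewrite -(bern_bernl be p al) !nrm_bern //.
set x := bernl be l' v; rewrite (dil_bernl _ al) -bernlB.
have := nrm_bernl_le (x - dil (p ^ 2) x) hl.
set a := nrm (bernl al l (_ - _)); set b := nrm (_ - _) => ab.
have : 0 <= be p * (1 - be p) * (b - a).
  by rewrite !mulr_ge0 // subr_ge0.
lra.
Qed.

(* The adjoint of an average of the [dil (m ^ 2)], up to one common dilation. *)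
Lemma ip_bernl_adj al l u v : {in l, forall p, (0 < p)%N} ->
  ip u (bernl al l v) =
  ip (bernl (fun p => 1 - al p) l u) (dil ((\prod_(p <- l) p) ^ 2) v).
Proof.
elim: l u v => [|p l IH] u v H /=; first by rewrite big_nil dil1.
rewrite big_cons expnMn mulnC -dil_dil.
have p0 := H p (mem_head _ _).
have H' : {in l, forall p, (0 < p)%N} by move=> q ql; apply: H; rewrite inE ql orbT.
have e : ip u (bern al p (bernl al l v)) =
    ip (bern (fun p => 1 - al p) p u) (dil (p ^ 2) (bernl al l v)).
  rewrite /bern ipDr !ipZr ipDl !ipZl subKr ip_dil ?expn_gt0 ?p0 //; ring.
by rewrite e dil_bernl IH // bern_bernl [dil (_ ^ 2) (dil _ _)]dilC.
Qed.

(** The energy formula [nrm_bern] is unchanged when [al p] becomes [1 - al p]. *)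
Lemma nrm_bernl_adj al l v : {in l, forall p, (0 < p)%N} ->
  nrm (bernl (fun p => 1 - al p) l v) = nrm (bernl al l v).
Proof.
elim: l v => //= p l IH v H; have p0 := H p (mem_head _ _).
rewrite bern_bernl IH; last by move=> q ql; apply: H; rewrite inE ql orbT.
rewrite -bern_bernl !nrm_bern //; congr (_ - _); ring.
Qed.
End InnerProduct.

(** * Sums over integers and their prime factors *)

Section SumsOverSequences.
Context {R : realType}.

Lemma ler_sum_sub (I : eqType) (r t : seq I) (F : I -> R) :
  uniq r -> {subset r <= t} -> (forall i, 0 <= F i) ->
  \sum_(i <- r) F i <= \sum_(i <- t) F i.
Proof.
move=> + + F0; elim: r t => [|x r IH] t /=.
  by move=> _ _; rewrite big_nil; apply: sumr_ge0 => i _.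
move=> /andP[xr ur] rt; have xt : x \in t by apply: rt; rewrite inE eqxx.
rewrite big_cons (big_rem x xt) /= lerD2l; apply: IH => // y yr.
have : y \in t by apply: rt; rewrite inE yr orbT.
rewrite (perm_mem (perm_to_rem xt)) inE => /orP[/eqP yx|//].
by rewrite -yx yr in xr.
Qed.

Lemma ler_sum_cover (I J : eqType) (r : seq I) (t : seq J) (g : J -> I) (F : I -> R) :
  uniq r -> (forall i, i \in r -> exists2 j, j \in t & g j = i) ->
  (forall i, 0 <= F i) ->
  \sum_(i <- r) F i <= \sum_(j <- t) F (g j).
Proof.
move=> ur rt F0; rewrite -(big_map g xpredT F); apply: ler_sum_sub => // i /rt.
by move=> [j jt <-]; apply: map_f.
Qed.

Lemma ler_sum_inj (I J : eqType) (r : seq I) (t : seq J) (h : I -> J) (F : J -> R) :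
  uniq r -> {in r &, injective h} -> (forall i, i \in r -> h i \in t) ->
  (forall j, 0 <= F j) ->
  \sum_(i <- r) F (h i) <= \sum_(j <- t) F j.
Proof.
move=> ur hi rt F0; rewrite -(big_map h xpredT F); apply: ler_sum_sub => //.
  by rewrite map_inj_in_uniq.
by move=> j /mapP[i ir ->]; apply: rt.
Qed.

Lemma sum_pairs (I J : eqType) (r : seq I) (t : seq J) (F : I -> J -> R) :
  \sum_(x <- [seq (i, j) | i <- r, j <- t]) F x.1 x.2 =
  \sum_(i <- r) \sum_(j <- t) F i j.
Proof. by rewrite big_allpairs. Qed.

Lemma ler_sum_nat_iota (F : nat -> R) m n n' : (n <= n')%N -> (forall i, 0 <= F i) ->
  \sum_(m <= i < n) F i <= \sum_(m <= i < n') F i.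
Proof.
move=> nn F0; apply: ler_sum_sub => //; first exact: iota_uniq.
move=> i; rewrite !mem_index_iota => /andP[-> ] /= /leq_trans; exact.
Qed.
End SumsOverSequences.

Lemma big_divisors_primeM (V : nmodType) (F : nat -> V) p P :
  prime p -> (0 < P)%N -> ~~ (p %| P)%N ->
  \sum_(n <- divisors (p * P)) F n =
  \sum_(n <- divisors P) F n + \sum_(n <- divisors P) F (p * n)%N.
Proof.
move=> pp P0 pP; have p0 := prime_gt0 pp.
rewrite -(big_map (muln p) xpredT F) -big_cat; apply: perm_big; apply: uniq_perm.
- exact: divisors_uniq.
- rewrite cat_uniq divisors_uniq map_inj_uniq ?divisors_uniq; last first.
    by move=> i j /eqP; rewrite eqn_pmul2l // => /eqP.
  rewrite andbT; apply/hasPn => _ /mapP[n _ ->]; rewrite -dvdn_divisors //.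
  by apply: contra pP => /(dvdn_trans (dvdn_mulr _ _)); apply.
- move=> d; rewrite mem_cat -!dvdn_divisors ?muln_gt0 ?p0 //.
  apply/idP/orP.
    have [/dvdnP[k ->]|pd] := boolP (p %| d)%N.
      rewrite mulnC dvdn_pmul2l // => kP; right.
      by apply: map_f; rewrite -dvdn_divisors.
    by rewrite Gauss_dvdr; [left|rewrite coprime_sym prime_coprime].
  case=> [dP|/mapP[n + ->]]; first exact: dvdn_mull.
  by rewrite -dvdn_divisors // dvdn_pmul2l.
Qed.

Definition sqfree (f : nat) : Prop := forall p, prime p -> ~~ (p ^ 2 %| f)%N.

Lemma sqfree_dvdn_prod f (l : seq nat) : (0 < f)%N -> sqfree f ->
  (forall p, prime p -> (p %| f)%N -> p \in l) -> (f %| \prod_(p <- l) p)%N.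
Proof.
elim: l f => [|q l IH] f f0 sf H.
  rewrite big_nil; have [f1|f1] := leqP f 1.
    by have -> : f = 1%N by apply/eqP; rewrite eqn_leq f1.
  by have := H _ (pdiv_prime f1) (pdiv_dvd f).
rewrite big_cons.
have [/andP[pq /dvdnP[k fE]]|nq] := boolP (prime q && (q %| f)%N).
  rewrite fE mulnC dvdn_pmul2l ?prime_gt0 //; apply: IH.
  - by move: f0; rewrite fE muln_gt0 => /andP[].
  - by move=> p pp; apply: contra (sf p pp) => h; rewrite fE dvdn_mulr.
  - move=> p pp pk; have : p \in q :: l by apply: H => //; rewrite fE dvdn_mulr.
    rewrite inE => /orP[/eqP pe|//].
    by have := sf q pq; rewrite fE -pe expnS expn1 dvdn_mul.
apply: dvdn_mull; apply: IH => // p pp pf; have := H p pp pf.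
by rewrite inE => /orP[/eqP pe|//]; rewrite -pe pp pf in nq.
Qed.

(** Take [d ^ 2] to be the largest square dividing [n]; a square left in [f] would enlarge it. *)
Lemma sq_sqfree_decomp n : (0 < n)%N ->
  exists d f, [/\ n = (d ^ 2 * f)%N, (0 < d)%N, (0 < f)%N & sqfree f].
Proof.
move=> n0; pose Q d := (d ^ 2 %| n)%N.
have Q1 : exists d, Q d by exists 1%N; rewrite /Q dvd1n.
have Qb d : Q d -> (d <= n)%N.
  move=> /(dvdn_leq n0); apply: leq_trans.
  by rewrite expnS expn1; case: d => // d; rewrite leq_pmulr.
have := ex_maxnP Q1 Qb; case => d /dvdnP[f nE] dmax.
have d0 : (0 < d)%N.
  by case: d nE {dmax} => // nE; rewrite nE exp0n // muln0 in n0.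
have f0 : (0 < f)%N by move: n0; rewrite nE muln_gt0 => /andP[].
exists d, f; split=> //; first by rewrite mulnC.
move=> p pp; apply/negP => /dvdnP[k fE].
have : (d * p <= d)%N by apply: dmax; rewrite /Q nE fE expnMn mulnC -mulnA dvdn_mull.
by rewrite -{2}[d]muln1 leq_pmul2l // leqNgt prime_gt1.
Qed.

Definition primes_in (w y : nat) : seq nat := [seq p <- index_iota w.+1 y.+1 | prime p].
(** Its divisors are the products of distinct primes in [(w, y]], the values of the random [r]. *)
Definition pprod (w y : nat) : nat := \prod_(p <- primes_in w y) p.

Lemma mem_primes_in w y p : (p \in primes_in w y) = [&& prime p, (w < p)%N & (p <= y)%N].
Proof. by rewrite mem_filter mem_index_iota ltnS. Qed.

Lemma primes_in_uniq w y : uniq (primes_in w y).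
Proof. exact/filter_uniq/iota_uniq. Qed.

Lemma primes_in_cat w z y : (w <= z)%N -> (z <= y)%N ->
  primes_in w y = primes_in w z ++ primes_in z y.
Proof.
move=> wz zy; rewrite /primes_in -filter_cat; apply: congr1.
rewrite /index_iota !subSS.
have -> : (y - w = (z - w) + (y - z))%N by rewrite addnC addnBA // subnK.
by rewrite iotaD addSn subnKC.
Qed.

Lemma prod_primes_gt0 (l : seq nat) : all prime l -> (0 < \prod_(p <- l) p)%N.
Proof.
move=> /allP lp; rewrite big_seq; apply: prodn_cond_gt0 => p pl.
by apply: prime_gt0; apply: lp.
Qed.

Lemma prime_dvd_prod p (l : seq nat) : prime p -> all prime l ->
  (p %| \prod_(q <- l) q)%N = (p \in l).
Proof.
move=> pp; elim: l => [|q l IH] /=; first by rewrite big_nil Euclid_dvd1.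
move=> /andP[pq lp]; rewrite big_cons Euclid_dvdM // IH // inE.
by rewrite dvdn_prime2.
Qed.

Lemma primes_in_prime w y : all prime (primes_in w y).
Proof. by apply/allP => p; rewrite mem_filter => /andP[]. Qed.

Lemma pprod_gt0 w y : (0 < pprod w y)%N.
Proof. exact/prod_primes_gt0/primes_in_prime. Qed.

(** * The weights [n^-(1+s)] and their Euler products *)

Section Weights.
Context {R : realType}.
Implicit Types (s : R) (n : nat).

Definition wt s n : R := n%:R `^ (- (1 + s)).

Lemma wt_ge0 s n : 0 <= wt s n. Proof. exact: powR_ge0. Qed.

Lemma wt1 s : wt s 1 = 1. Proof. by rewrite /wt powR1. Qed.

Lemma wtM s m n : wt s (m * n) = wt s m * wt s n.
Proof. by rewrite /wt natrM powRM. Qed.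

Lemma wt_mono s s' n : (0 < n)%N -> s' <= s -> wt s n <= wt s' n.
Proof. by move=> n0 ss; apply: ler_powR; rewrite ?ler1n //; lra. Qed.

Lemma wt0 n : wt 0 n = n%:R^-1.
Proof. by rewrite /wt addr0 powR_inv1. Qed.

Lemma wt_le_inv s n : (0 < n)%N -> 0 <= s -> wt s n <= n%:R^-1.
Proof. by move=> n0 s0; rewrite -wt0 wt_mono. Qed.

Lemma wt_le1 s n : (0 < n)%N -> 0 <= s -> wt s n <= 1.
Proof.
move=> n0 s0; apply: le_trans (wt_le_inv n0 s0) _.
by rewrite invf_le1 ?ltr0n // ler1n.
Qed.

Lemma wtD s t n : (0 < n)%N -> wt (s + t) n = wt s n * n%:R `^ (- t).
Proof.
move=> n0; rewrite /wt -powRD; first by congr (_ `^ _); ring.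
by rewrite pnatr_eq0 -lt0n n0 implybT.
Qed.

(** Up to [exp (1/s)] the factor [n^-s] is at least [1/e], so the weight is comparable with [1/n]
    there. *)
Lemma wt_ge s n : (0 < n)%N -> s * ln n%:R <= 1 -> n%:R^-1 <= expR 1 * wt s n.
Proof.
move=> n0 sn; rewrite -[s]add0r wtD // wt0 mulrCA ler_peMr ?invr_ge0 //.
rewrite /powR pnatr_eq0 gtn_eqF // -expRD -[leLHS]expR0 ler_expR.
by rewrite mulNr; lra.
Qed.

Lemma ln_nat_sub n : (0 < n)%N ->
  n.+1%:R^-1 <= ln n.+1%:R - ln n%:R :> R.
Proof.
move=> n0.
have p1 : (0 : R) < n.+1%:R by rewrite ltr0n.
have p2 : (0 : R) < n%:R by rewrite ltr0n.
have e : ln n%:R - ln n.+1%:R = ln (1 + - n.+1%:R^-1) :> R.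
  rewrite -lnV ?posrE // -lnM ?posrE ?invr_gt0 //; congr (ln _).
  by rewrite -natr1; field; rewrite natr1 gt_eqF.
have := @le_ln1Dx R (- n.+1%:R^-1).
rewrite -e; suff h : -1 < - (n.+1%:R^-1) :> R
  by move=> /(_ h); move: (_^-1) (ln _) (ln _) => c x y; lra.
by rewrite ltrN2 invf_lt1 ?ltr1n.
Qed.

Lemma sum_wt_le s X : 0 < s -> \sum_(1 <= n < X.+1) wt s n <= 1 + s^-1.
Proof.
move=> s0.
(* The stronger bound keeps the integral of [x^-(1+s)] from 1 to [X+1], so that the induction
   telescopes. *)
suff H : \sum_(1 <= n < X.+2) wt s n <= 1 + s^-1 * (1 - X.+1%:R `^ (- s)).
  apply: le_trans (le_trans (ler_sum_nat_iota _ (leqnSn _) (wt_ge0 s)) H) _.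
  by rewrite lerD2l ler_piMr ?invr_ge0 ?ltW // gerBl powR_ge0.
elim: X => [|X IH].
  by rewrite big_nat1 wt1 powR1 subrr mulr0 addr0.
rewrite big_nat_recr //=; apply: le_trans (lerD IH (lexx _)) _.
rewrite -addrA lerD2l -(ler_pM2l s0) mulrDr !mulrA divff ?gt_eqF // !mul1r.
suff : s * wt s X.+2 <= X.+1%:R `^ (- s) - X.+2%:R `^ (- s) by lra.
have := @ln_nat_sub X.+1 (ltn0Sn _).
rewrite -[in wt s _](add0r s) wtD // wt0 /powR !pnatr_eq0 /=.
set a := ln X.+1%:R; set b := ln X.+2%:R; set c := X.+2%:R^-1 => cb.
have -> : - s * a = - s * b + s * (b - a) by ring.
rewrite expRD.
have h1 := expR_ge1Dx (s * (b - a)).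
have h2 : s * c <= s * (b - a) by rewrite ler_pM2l.
have h3 := expR_gt0 (- s * b).
have : expR (- s * b) * (1 + s * c) <= expR (- s * b) * expR (s * (b - a)).
  by rewrite ler_pM2l //; lra.
by lra.
Qed.

Definition harm (X : nat) : R := \sum_(1 <= n < X.+1) n%:R^-1.

Lemma harm_ge X : ln X.+1%:R <= harm X.
Proof.
rewrite /harm; elim: X => [|X IH]; first by rewrite big_geq // ln1.
rewrite big_nat_recr //=; apply: le_trans (lerD IH (lexx _)).
have p1 : (0 : R) < X.+1%:R by rewrite ltr0n.
have p2 : (0 : R) < X.+2%:R by rewrite ltr0n.
have -> : X.+2%:R = X.+1%:R * (1 + X.+1%:R^-1) :> R.
  by rewrite mulrDr mulr1 divff ?gt_eqF // natr1.
have p3 : (0 : R) < X.+1%:R^-1 by rewrite invr_gt0.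
rewrite lnM ?posrE ?addr_gt0 // lerD2l.
by apply: le_ln1Dx; apply: lt_trans p3; rewrite ltrN10.
Qed.

Lemma harm_le X : (0 < X)%N -> harm X <= 1 + ln X%:R.
Proof.
rewrite /harm; elim: X => // -[|X] IH _.
  by rewrite big_nat1 invr1 ln1 addr0.
rewrite big_nat_recr //=; apply: le_trans (lerD (IH _) (lexx _)) _ => //.
have := @ln_nat_sub X.+1 (ltn0Sn _); move: (_^-1) (ln _) (ln _) => c x y; lra.
Qed.

Lemma harm_ge0 X : 0 <= harm X.
Proof. by apply: sumr_ge0 => n _; rewrite invr_ge0. Qed.

Lemma sum_inv_sq_le w X : (0 < w)%N ->
  \sum_(w.+1 <= d < X.+1) (d%:R ^+ 2)^-1 <= w%:R^-1 :> R.
Proof.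
move=> w0; have w0' : (0 : R) < w%:R by rewrite ltr0n.
have [wX|Xw] := leqP w X; last by rewrite big_geq ?invr_ge0 // ltnW.
suff : \sum_(w.+1 <= d < X.+1) (d%:R ^+ 2)^-1 <= w%:R^-1 - X%:R^-1 :> R.
  by move=> h; apply: le_trans h _; rewrite gerBl invr_ge0.
elim: X wX => [|X IH]; first by rewrite leqn0 => /eqP ->; rewrite big_geq // subrr.
rewrite leq_eqVlt => /orP[/eqP ->|]; first by rewrite big_geq // subrr.
rewrite ltnS => wX; rewrite big_nat_recr //=.
apply: le_trans (lerD (IH wX) (lexx _)) _.
have x0 : (0 : R) < X%:R by rewrite ltr0n (leq_trans w0).
have -> : X.+1%:R = X%:R + 1 :> R by rewrite natr1.
rewrite -addrA lerD2l -subr_ge0.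
have -> : - (X%:R + 1)^-1 - (- X%:R^-1 + ((X%:R + 1) ^+ 2)^-1) =
  (X%:R * (X%:R + 1) ^+ 2)^-1 :> R by field; apply/andP; split; apply: lt0r_neq0; lra.
by rewrite invr_ge0 mulr_ge0 ?sqr_ge0 // ltW.
Qed.

Lemma sum_inv_sq_le2 X : \sum_(1 <= d < X.+1) (d%:R ^+ 2)^-1 <= 2 :> R.
Proof.
case: X => [|X]; first by rewrite big_geq.
rewrite big_ltn // expr1n invr1.
have := @sum_inv_sq_le 1 X.+1 isT; rewrite invr1; lra.
Qed.

(** The Euler product over [l]: for distinct primes it normalises the law of [r]. *)
Definition Zwt s (l : seq nat) : R := \prod_(p <- l) (1 + wt s p).

Lemma Zwt_ge1 s l : 1 <= Zwt s l.
Proof.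
rewrite /Zwt; elim: l => [|p l IH]; rewrite ?big_nil // big_cons.
by rewrite -[leLHS]mulr1 ler_pM //; have := wt_ge0 s p; lra.
Qed.

Lemma Zwt_gt0 s l : 0 < Zwt s l.
Proof. exact: lt_le_trans (Zwt_ge1 s l). Qed.

Lemma Zwt_cat s l l' : Zwt s (l ++ l') = Zwt s l * Zwt s l'.
Proof. by rewrite /Zwt big_cat. Qed.

Lemma Zwt_le2 s l : 0 <= s -> all prime l -> Zwt s l <= 2 ^+ size l.
Proof.
move=> s0; elim: l => [|p l IH] /=; first by rewrite /Zwt big_nil.
move=> /andP[pp lp]; rewrite /Zwt big_cons exprS ler_pM //.
- by have := wt_ge0 s p; lra.
- exact: le_trans (Zwt_ge1 s l).
- have := wt_le1 (prime_gt0 pp) s0; lra.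
- exact: IH.
Qed.

(** The probability that [p] divides [r], when [r] is drawn with weights [wt s r] among products of
    distinct primes. *)
Definition bal s (p : nat) : R := wt s p / (1 + wt s p).

Lemma bal01 s p : 0 <= bal s p <= 1.
Proof.
have w0 := wt_ge0 s p; rewrite /bal; apply/andP; split.
  by rewrite divr_ge0 //; lra.
by rewrite ler_pdivrMr ?mul1r; lra.
Qed.

(** With [x = wt s p] the quantity is [x / (1 + x)^2], increasing on [[0, 1]], and [wt] decreases in
    [s]. *)
Lemma bal_mono s s' p : (0 < p)%N -> 0 <= s' -> s' <= s ->
  bal s p * (1 - bal s p) <= bal s' p * (1 - bal s' p).
Proof.
move=> p0 s0 ss; rewrite /bal.
have := wt_mono p0 ss; have := wt_ge0 s p; have := wt_le1 p0 s0.
move: (wt s p) (wt s' p) => a b b1 a0 ab.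
rewrite -subr_ge0.
have -> : b / (1 + b) * (1 - b / (1 + b)) - a / (1 + a) * (1 - a / (1 + a)) =
  (b - a) * (1 - a * b) / ((1 + a) ^+ 2 * (1 + b) ^+ 2).
  by field; apply/andP; split; apply: lt0r_neq0; lra.
apply: divr_ge0; last by rewrite mulr_ge0 ?sqr_ge0.
apply: mulr_ge0; first lra.
have : a * b <= 1 * 1 by apply: ler_pM; lra.
lra.
Qed.

Lemma sum_divisors_wt s l : all prime l -> uniq l ->
  \sum_(n <- divisors (\prod_(p <- l) p)) wt s n = Zwt s l.
Proof.
elim: l => [|p l IH] /=; first by rewrite /Zwt !big_nil (_ : divisors 1 = [:: 1%N]) // big_seq1 wt1.
move=> /andP[pp lp] /andP[pl ul].
rewrite /Zwt !big_cons big_divisors_primeM // ?prod_primes_gt0 ?prime_dvd_prod //.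
under [X in _ + X]eq_bigr do rewrite wtM.
by rewrite -mulr_sumr IH // mulrDl mul1r.
Qed.

(** Expanding the product of independent choices yields each divisor once, with a weight that
    factors over its primes. *)
Lemma bernl_expand s l (v : {poly R}) : all prime l -> uniq l ->
  bernl (bal s) l v =
  (Zwt s l)^-1 *: \sum_(n <- divisors (\prod_(p <- l) p)) wt s n *: dil (n ^ 2) v.
Proof.
elim: l => [|p l IH] /=.
  by rewrite /Zwt !big_nil (_ : divisors 1 = [:: 1%N]) // big_seq1 wt1 dil1 invr1 !scale1r.
move=> /andP[pp lp] /andP[pl ul].
rewrite big_cons big_divisors_primeM // ?prod_primes_gt0 ?prime_dvd_prod //.
rewrite IH // {IH}; set P := \prod_(q <- l) q.
set S := \sum_(n <- divisors P) _.
have -> : \sum_(n <- divisors P) wt s (p * n) *: dil ((p * n) ^ 2) v =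
    wt s p *: dil (p ^ 2) S.
  rewrite dil_sum scaler_sumr; apply: eq_bigr => n _.
  by rewrite wtM expnMn -dil_dil dilZ scalerA.
rewrite /bern dilZ /Zwt big_cons -/(Zwt s l) /bal.
have z0 := Zwt_gt0 s l; have w0 := wt_ge0 s p.
have w1 : 1 + wt s p != 0 by apply: lt0r_neq0; lra.
rewrite scalerDr !scalerA; congr (_ *: _ + _ *: _).
  by field; rewrite w1 gt_eqF.
by field; rewrite w1 gt_eqF.
Qed.
End Weights.

Lemma prime_dvdn_pprod w y r p : prime p -> (p %| r)%N -> (r %| pprod w y)%N ->
  p \in primes_in w y.
Proof.
move=> pp pr rP; rewrite -prime_dvd_prod ?primes_in_prime //.
exact: dvdn_trans rP.
Qed.

Lemma sqfree_dvdn_pprod f y : (0 < f <= y)%N -> sqfree f -> (f %| pprod 0 y)%N.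
Proof.
move=> /andP[f0 fy] sf; apply: sqfree_dvdn_prod => // p pp pf.
by rewrite mem_primes_in pp prime_gt0 //= (leq_trans (dvdn_leq f0 pf)).
Qed.

Lemma pprod_cat w z y : (w <= z)%N -> (z <= y)%N ->
  pprod w y = (pprod w z * pprod z y)%N.
Proof. by move=> wz zy; rewrite /pprod (primes_in_cat wz zy) big_cat. Qed.

(* Excludes both a repeated prime above [w] and a large [w]-smooth part. *)
Definition sqlight (w n : nat) : bool :=
  all (fun d => ~~ (d ^ 2 %| n)%N) (index_iota w.+1 n.+1).

Lemma sqlightP w n d : (0 < n)%N -> sqlight w n -> (d ^ 2 %| n)%N -> (d <= w)%N.
Proof.
move=> n0 /allP H dn; rewrite leqNgt; apply/negP => wd.
have d0 : (0 < d)%N by apply: leq_trans wd.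
have : (d <= n)%N.
  by apply: leq_trans (dvdn_leq n0 dn); rewrite expnS expn1 leq_pmulr.
by move=> dn'; have := H d; rewrite mem_index_iota wd ltnS dn' dn => /(_ isT).
Qed.

Section GoodNumbers.
Variables (w y n : nat).
Hypotheses (wy : (w <= y)%N) (n0 : (0 < n)%N) (ny : (n <= y)%N).
Hypothesis good : sqlight w n.

Let P := pprod w y.

(** A prime of [P] dividing the quotient also divides the gcd, hence divides [n] twice, although it
    exceeds [w]. *)
Lemma coprime_rough_part : coprime (n %/ gcdn n P) P.
Proof.
rewrite coprime_has_primes ?pprod_gt0 //; last first.
  by rewrite divn_gt0 ?gcdn_gt0 ?n0 // dvdn_leq // dvdn_gcdl.
apply/hasPn => p; rewrite mem_primes => /and3P[pp _ pP].
apply/negP; rewrite mem_primes => /and3P[_ _ pn].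
have pg : (p %| gcdn n P)%N.
  rewrite dvdn_gcd pP andbT; apply: dvdn_trans pn _.
  by rewrite -[X in (_ %| X)%N](divnK (dvdn_gcdl n P)) dvdn_mulr.
have : (p ^ 2 %| n)%N.
  by rewrite -(divnK (dvdn_gcdl n P)) expnS expn1 dvdn_mul.
move=> /(sqlightP n0 good); rewrite leqNgt => /negP; apply.
by have := prime_dvdn_pprod pp pP (dvdnn P); rewrite mem_primes_in => /and3P[].
Qed.

(** Write [n = d^2 f] with [f] squarefree: [d <= w], and the primes of [f] above [w] are absorbed by
    the gcd. The bound is uniform in [n] and [y]. *)
Lemma smooth_part_le : (n %/ gcdn n P <= w ^ 2 * pprod 0 w)%N.
Proof.
have [d [f [nE d0 f0 sf]]] := sq_sqfree_decomp n0.
have fn : (f <= y)%N by apply: leq_trans ny; rewrite nE leq_pmull // expn_gt0 d0.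
have fP : (f %| pprod 0 w * P)%N.
  by rewrite -pprod_cat //; apply: sqfree_dvdn_pprod; rewrite ?f0.
have dw : (d <= w)%N by apply: (sqlightP n0 good); rewrite nE dvdn_mulr.
rewrite leq_divLR ?dvdn_gcdl //.
have fg : (f %| pprod 0 w * gcdn n P)%N.
  by rewrite muln_gcdr dvdn_gcd fP andbT dvdn_mull // nE dvdn_mull.
rewrite [X in (X <= _)%N]nE -mulnA leq_mul ?leq_sqr //.
by apply: dvdn_leq; rewrite // muln_gt0 pprod_gt0 gcdn_gt0 n0.
Qed.
End GoodNumbers.

(** * Estimates for sums of weights *)

Section WeightEstimates.
Context {R : realType}.
Implicit Types (s : R).

(** Bounds [Z] below by a multiple of [1/s]: weights replace [1/n], each [n] is a square times a
    product of distinct primes, the squares sum to at most 2, and each prime up to [w] costs a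
    factor at most 2. *)
Lemma harm_le_Zwt s w y T : (w <= y)%N -> (T <= y)%N -> 0 <= s ->
  s * ln T%:R <= 1 ->
  harm T <= expR 1 * 2 ^+ w.+1 * Zwt s (primes_in w y) :> R.
Proof.
move=> wy Ty s0 sT.
have h1 : harm T <= expR 1 * \sum_(1 <= n < T.+1) wt s n.
  rewrite /harm mulr_sumr big_nat [leRHS]big_nat; apply: ler_sum => n.
  rewrite ltnS => /andP[n1 nT]; apply: wt_ge => //.
  apply: le_trans sT; apply: ler_wpM2l => //.
  by rewrite ler_ln ?posrE ?ltr0n ?ler_nat // (leq_trans n1).
apply: le_trans h1 _; rewrite -!mulrA ler_pM2l ?expR_gt0 //.
have h2 : \sum_(1 <= n < T.+1) wt s n <=
    (\sum_(1 <= d < T.+1) (d%:R ^+ 2)^-1) * Zwt s (primes_in 0 y).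
  rewrite -sum_divisors_wt ?primes_in_prime ?primes_in_uniq // mulr_suml.
  apply: (@le_trans _ _ (\sum_(1 <= d < T.+1)
      \sum_(f <- divisors (pprod 0 y)) wt s (d ^ 2 * f))).
    rewrite -(sum_pairs _ _ (fun d f => wt s (d ^ 2 * f))).
    apply: (ler_sum_cover (g := fun x => (x.1 ^ 2 * x.2)%N)).
    - exact: iota_uniq.
    - move=> n; rewrite mem_index_iota ltnS => /andP[n0 nT].
      have [d [f [nE d0 f0 sf]]] := sq_sqfree_decomp n0.
      exists (d, f) => //=; apply/allpairsP; exists (d, f); split=> //=.
        rewrite mem_index_iota d0 ltnS; apply: leq_trans nT.
        by rewrite nE expnS expn1 -mulnA leq_pmulr // muln_gt0 d0.
      rewrite -dvdn_divisors ?pprod_gt0 // sqfree_dvdn_pprod // f0.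
      apply: leq_trans Ty; apply: leq_trans nT.
      by rewrite nE leq_pmull // expn_gt0 d0.
    - by move=> n; apply: wt_ge0.
  rewrite big_nat [leRHS]big_nat; apply: ler_sum => d /andP[d1 _].
  rewrite mulr_sumr; apply: ler_sum => f _; rewrite wtM ler_wpM2r ?wt_ge0 //.
  by rewrite -natrX wt_le_inv // expn_gt0 d1.
apply: le_trans h2 _; rewrite exprS -mulrA; apply: ler_pM.
- by apply: sumr_ge0 => d _; rewrite invr_ge0 sqr_ge0.
- exact/ltW/Zwt_gt0.
- exact: sum_inv_sq_le2.
rewrite (primes_in_cat (leq0n w) wy) Zwt_cat ler_wpM2r ?(ltW (Zwt_gt0 _ _)) //.
apply: le_trans (Zwt_le2 s0 (primes_in_prime 0 w)) _.
rewrite ler_eXn2l ?ltr1n // size_filter (leq_trans (count_size _ _)) //.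
by rewrite size_iota subSS subn0.
Qed.

Lemma sum_divisors_wt_le s P : 0 < s -> (0 < P)%N ->
  \sum_(r <- divisors P) wt s r <= 1 + s^-1.
Proof.
move=> s0 P0; apply: le_trans (sum_wt_le P s0).
apply: ler_sum_sub; first exact: divisors_uniq.
  move=> r; rewrite -dvdn_divisors // mem_index_iota => rP.
  by rewrite ltnS (dvdn_leq P0 rP) (dvdn_gt0 P0 rP).
by move=> r; apply: wt_ge0.
Qed.

(** Rankin's trick: beyond [Y] the factor [r^-(s/2)] is at most [Y^-(s/2)], and the other half of
    [s] still controls the sum. *)
Lemma sum_divisors_wt_tail s P (Y : R) : 0 < s -> (0 < P)%N -> 0 < Y ->
  \sum_(r <- divisors P | Y < r%:R) wt s r <= Y `^ (- (s / 2)) * (1 + 2 / s).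
Proof.
move=> s0 P0 Y0; have s2 : 0 < s / 2 by lra.
have := sum_divisors_wt_le s2 P0; rewrite invf_div => /(ler_wpM2l (powR_ge0 Y (- (s / 2)))).
apply: le_trans; rewrite mulr_sumr big_mkcond /= big_seq [leRHS]big_seq.
apply: ler_sum => r; rewrite -dvdn_divisors // => rP.
have r0 := dvdn_gt0 P0 rP.
case: ifP => [Yr|_]; last by rewrite mulr_ge0 ?powR_ge0 ?wt_ge0.
have {1}-> : s = s / 2 + s / 2 by lra.
rewrite wtD // mulrC ler_wpM2r ?wt_ge0 // !powRN.
rewrite lef_pV2 ?posrE ?powR_gt0 ?ltr0n //.
by apply: ge0_ler_powR; rewrite ?nnegrE ?ler0n ?ltW.
Qed.

(** Union bound over the [d > w] with [d ^ 2] dividing [n]. *)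
Lemma harm_sqheavy_le w X : (0 < w)%N ->
  \sum_(1 <= n < X.+1 | ~~ sqlight w n) n%:R^-1 <= w%:R^-1 * harm X :> R.
Proof.
move=> w0.
have h : \sum_(1 <= n < X.+1 | ~~ sqlight w n) n%:R^-1 <=
    \sum_(w.+1 <= d < X.+1) \sum_(1 <= k < X.+1) (d ^ 2 * k)%:R^-1 :> R.
  rewrite -(sum_pairs _ _ (fun d k => (d ^ 2 * k)%:R^-1)) -big_filter.
  apply: (@ler_sum_cover _ _ _ _ _ (fun x => (x.1 ^ 2 * x.2)%N) (fun n => n%:R^-1)).
  - exact/filter_uniq/iota_uniq.
  - move=> n; rewrite mem_filter mem_index_iota ltnS => /and3P[+ n0 nX].
    move=> /allPn[d]; rewrite mem_index_iota negbK ltnS => /andP[wd dn] /dvdnP[k nE].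
    exists (d, k); last by rewrite /= mulnC.
    apply/allpairsP; exists (d, k); split=> //=.
      by rewrite mem_index_iota wd ltnS (leq_trans dn).
    have : (0 < k)%N by move: n0; rewrite nE muln_gt0 => /andP[].
    rewrite mem_index_iota ltnS => ->; apply: leq_trans nX.
    by rewrite nE leq_pmulr // expn_gt0 (leq_ltn_trans (leq0n w) wd).
  - by move=> n; rewrite invr_ge0.
apply: le_trans h _.
under eq_bigr => d _.
  under eq_bigr do rewrite natrM natrX invfM.
  rewrite -mulr_sumr -/(harm X); over.
by rewrite -mulr_suml ler_wpM2r ?harm_ge0 // sum_inv_sq_le.
Qed.

(** Under these weights [gcdn n P] is dominated by the law of [r]. Indeed [n = a r] with [a] coprime
    to [P], and the sum over such [a] times [Z] is at most the full sum of weights, since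
    coprimality lets [a r] determine [a] and [r]. *)
Lemma sum_sqlight_le s w y X (F : nat -> R) : 0 < s -> (w <= y)%N ->
  (X <= y)%N -> (forall r, 0 <= F r) ->
  \sum_(1 <= n < X.+1 | sqlight w n) wt s n * F (gcdn n (pprod w y)) <=
  (1 + s^-1) * ((Zwt s (primes_in w y))^-1 *
    \sum_(r <- divisors (pprod w y)) wt s r * F r).
Proof.
move=> s0 wy Xy F0; set P := pprod w y; set Z := Zwt s _.
have P0 : (0 < P)%N := pprod_gt0 w y.
pose A := [seq a <- index_iota 1 X.+1 | coprime a P].
have h1 : \sum_(1 <= n < X.+1 | sqlight w n) wt s n * F (gcdn n P) <=
    \sum_(a <- A) \sum_(r <- divisors P) wt s a * (wt s r * F r).
  rewrite -(sum_pairs _ _ (fun a r => wt s a * (wt s r * F r))) -big_filter.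
  rewrite (eq_bigr (fun n => (fun x => wt s x.1 * (wt s x.2 * F x.2))
    (n %/ gcdn n P, gcdn n P)%N)); last first.
    by move=> n _ /=; rewrite mulrA -wtM divnK // dvdn_gcdl.
  apply: (@ler_sum_inj _ _ _ _ _ (fun n => (n %/ gcdn n P, gcdn n P)%N)
    (fun x => wt s x.1 * (wt s x.2 * F x.2))).
  - exact/filter_uniq/iota_uniq.
  - move=> i j _ _ [e1 e2].
    by rewrite -(divnK (dvdn_gcdl i P)) e1 e2 divnK // dvdn_gcdl.
  - move=> n; rewrite mem_filter mem_index_iota ltnS => /and3P[gn n0 nX].
    apply/allpairsP; exists (n %/ gcdn n P, gcdn n P)%N; split=> //=; last first.
      by rewrite -dvdn_divisors // dvdn_gcdr.
    rewrite mem_filter coprime_rough_part //=.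
    rewrite mem_index_iota ltnS divn_gt0 ?gcdn_gt0 ?n0 //.
    by rewrite dvdn_leq ?dvdn_gcdl //= (leq_trans (leq_div _ _)).
  - by move=> x; rewrite !mulr_ge0 ?wt_ge0.
apply: le_trans h1 _.
under eq_bigr do rewrite -mulr_sumr.
rewrite -mulr_suml mulrA ler_wpM2r //.
  by apply: sumr_ge0 => r _; rewrite mulr_ge0 ?wt_ge0.
rewrite ler_pdivlMr ?Zwt_gt0 // /Z -sum_divisors_wt ?primes_in_prime ?primes_in_uniq //.
apply: le_trans (sum_wt_le (X * P) s0).
rewrite mulr_suml; under [leLHS]eq_bigr do rewrite mulr_sumr.
rewrite -(sum_pairs _ _ (fun a r => wt s a * wt s r)).
under [leLHS]eq_bigr do rewrite -wtM.
apply: (@ler_sum_inj _ _ _ _ _ (fun x : nat * nat => (x.1 * x.2)%N) (wt s)).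
- apply: allpairs_uniq; [exact/filter_uniq/iota_uniq | exact: divisors_uniq |].
  by move=> [? ?] [? ?].
- have key x : x \in [seq (a, r) | a <- A, r <- divisors P] ->
      gcdn (x.1 * x.2) P = x.2.
    move=> /allpairsP[[a r] /= [+ rP ->]] /=; rewrite mem_filter => /andP[aP _].
    rewrite gcdnC Gauss_gcdr; last by rewrite coprime_sym.
    by apply/gcdn_idPr; rewrite dvdn_divisors.
  move=> x x' xA xA' e; have e2 : x.2 = x'.2 by rewrite -(key x) // -(key x') // e.
  have : x.1 = x'.1.
    have : (0 < x.2)%N by rewrite -(key x) // gcdn_gt0 P0 orbT.
    by move=> x20; apply/eqP; rewrite -(eqn_pmul2r x20) {2}e2 e.
  by move: x x' e2 {xA xA' e} => [a b] [a' b'] /= -> ->.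
- move=> _ /allpairsP[[a r] /= [+ + ->]] /=.
  rewrite mem_filter mem_index_iota ltnS => /and3P[_ a0 aX].
  rewrite -dvdn_divisors // => rP; rewrite mem_index_iota ltnS muln_gt0 a0.
  by rewrite (dvdn_gt0 P0 rP) leq_mul // dvdn_leq.
- by move=> n; apply: wt_ge0.
Qed.
End WeightEstimates.

(** * The zero-one law *)

(** The infimum [u w] over [y] and [s] is bounded and increasing in [w]. Taking [u w] near [sup u]
    and nearly optimal parameters leaves three gaps of at most [eps / 4]: [e w y s] above [u w],
    [e y y' s'] above [u y], and [u y] above [u w]. *)
Lemma energy_stabilises (R : realType) (e : nat -> nat -> R -> R) :
  (forall w y s, 0 <= e w y s <= 1) ->
  (forall w y y' s s', (y <= y')%N -> 0 < s' -> s' <= s -> e w y' s' <= e w y s) ->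
  (forall w w' y s, 0 < s -> (w <= w')%N -> e w y s <= e w' y s) ->
  forall eps, 0 < eps -> forall w0, exists w y0 s0,
    [/\ (w0 <= w)%N, (w <= y0)%N, 0 < s0 &
      forall y s, (y0 <= y)%N -> 0 < s -> s <= s0 ->
      exists y' s', [/\ (y <= y')%N, 0 < s', s' <= s &
        e w y s - (2 * e w y' s' - e y y' s') <= eps]].
Proof.
move=> e01 anti mono eps eps0 w0.
pose E w := [set x | exists y s, 0 < s /\ x = e w y s].
have Einf w : has_inf (E w).
  split; first by exists (e w 0%N 1), 0%N, 1.
  by exists 0 => _ [y [s [_ ->]]]; case/andP: (e01 w y s).
have uE w y s : 0 < s -> inf (E w) <= e w y s.
  by move=> s0; apply: ge_inf; [exact: (Einf w).2 | exists y, s].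
pose u w := inf (E w).
have u_mono w w' : (w <= w')%N -> u w <= u w'.
  move=> ww; apply: lb_le_inf; first exact: (Einf w').1.
  by move=> _ [y [s [s0 ->]]]; apply: le_trans (uE w y s s0) (mono _ _ _ _ s0 ww).
have e4 : 0 < eps / 4 by lra.
pose S := range u.
have Ssup : has_sup S.
  split; first by exists (u 0%N), 0%N.
  exists 1 => _ [w _ <-]; apply: le_trans (uE w 0%N 1 ltr01) _.
  by case/andP: (e01 w 0%N 1).
have [_ [w1 _ <-] w1E] := sup_adherent e4 Ssup.
pose w := maxn w0 w1.
have wE : sup S - eps / 4 < u w by apply: lt_le_trans w1E (u_mono _ _ (leq_maxr _ _)).
have [_ [y0 [s0 [s0_gt0 ->]]] y0E] := inf_adherent e4 (Einf w).
exists w, (maxn w y0), s0; split=> //; [exact: leq_maxl | exact: leq_maxl |].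
move=> y s; rewrite geq_max => /andP[wy yy] s_gt0 ss.
have [_ [y1 [s1 [s1_gt0 ->]]] y1E] := inf_adherent e4 (Einf y).
exists (maxn y y1), (Num.min s s1); split.
- exact: leq_maxl.
- by rewrite lt_min s_gt0.
- by rewrite ge_min lexx.
have m0 : 0 < Num.min s s1 by rewrite lt_min s_gt0.
have h1 := uE w (maxn y y1) _ m0.
have h2 := anti w _ _ _ _ yy s_gt0 ss.
have h3 : e y (maxn y y1) (Num.min s s1) <= e y y1 s1.
  by apply: anti; rewrite ?leq_maxr // ge_min lexx orbT.
have h4 : u y <= sup S by apply: ub_le_sup; [exact: Ssup.2 | exists y].
move: h1 h2 h3 h4 wE y0E y1E; rewrite -/(u w) -/(u y); lra.
Qed.

Section ZeroOneLaw.
Context (R : realType) (delta : R) (rho : nat -> nat -> R).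
Hypothesis K : dilation_kernel delta rho.
Notation nrm v := (ip rho v v).
Notation blk s w y := (bernl (bal s) (primes_in w y)).

Lemma primes_in_nil w y : (y <= w)%N -> primes_in w y = [::].
Proof. by move=> yw; rewrite /primes_in /index_iota subSS (eqP yw). Qed.

Let blk_le (s : R) w y v : nrm (blk s w y v) <= nrm v.
Proof.
apply: (nrm_bernl_le K) => p; rewrite mem_primes_in => /and3P[pp _ _].
by rewrite prime_gt0 ?bal01.
Qed.

Let blk_mono (s s' : R) w y v : 0 < s' -> s' <= s ->
  nrm (blk s' w y v) <= nrm (blk s w y v).
Proof.
move=> s0 ss; apply: (nrm_bernl_mono K) => p; rewrite mem_primes_in => /and3P[pp _ _].
by rewrite prime_gt0 // bal_mono ?prime_gt0 // ltW.
Qed.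

(* Spectrally: [blk] is a multiplier [c], and the integral of
   [|c|^2 (1 - |c|^2)] is at most [eps]. *)
Lemma zero_one_law eps : 0 < eps -> forall w0, exists w y0 s0,
  [/\ (w0 <= w)%N, (w <= y0)%N, 0 < s0 &
    forall y s, (y0 <= y)%N -> 0 < s -> s <= s0 ->
    nrm (blk s w y 'X) - nrm (blk s w y (blk s w y 'X)) <= eps].
Proof.
move=> eps0 w0; pose e w y s := nrm (blk s w y 'X).
have e01 w y s : 0 <= e w y s <= 1.
  rewrite /e (nrm_ge0 K) (le_trans (blk_le _ _ _ _)) //.
  by rewrite -['X]expr1 ipXn (kernel_le1 K).
have anti w y y' s s' : (y <= y')%N -> 0 < s' -> s' <= s -> e w y' s' <= e w y s.
  move=> yy s0 ss; have [wy|/ltnW yw] := leqP w y; last first.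
    by rewrite /e (primes_in_nil yw).
  rewrite /e (primes_in_cat wy yy) bernl_cat bernlC.
  by apply: le_trans (blk_le _ _ _ _) (blk_mono _ _ _ s0 ss).
have mono w w' y s : 0 < s -> (w <= w')%N -> e w y s <= e w' y s.
  move=> s0 ww; have [wy|/ltnW yw] := leqP w' y; last first.
    by rewrite /e (primes_in_nil yw).
  by rewrite /e (primes_in_cat ww wy) bernl_cat.
have [w [y0 [s0 [h1 h2 h3 H]]]] := energy_stabilises e01 anti mono eps0 w0.
exists w, y0, s0; split=> // y s yy s_gt0 ss.
have [y' [s' [yy' s'0 ss']]] := H y s yy s_gt0 ss.
have wy : (w <= y)%N by apply: leq_trans yy.
apply: le_trans; rewrite lerD2l lerN2 /e.
rewrite (primes_in_cat wy yy') bernl_cat.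
(* With [A] and [A'] the averages over [(w, y]] for [s] and [s'], it remains to bound
   [2 |A' x|^2 - |x|^2] by [|A A' x|^2]: the defect of [A] at [A' x] is at most that at [x], and
   [|A' x| <= |A x|]. *)
set x := blk s' y y' 'X.
have s1 : nrm (blk s' w y (blk s w y 'X)) <= nrm (blk s w y (blk s w y 'X)).
  exact: blk_mono.
apply: le_trans s1; rewrite bernlC.
have s2 := blk_le s' y y' (blk s w y (blk s' w y 'X)).
apply: le_trans s2; rewrite bernlC [blk s' y y' (blk s' w y _)]bernlC -/x.
have Hl (t : R) z z' : {in primes_in z z', forall p, (0 < p)%N /\ 0 <= bal t p <= 1}.
  by move=> p; rewrite mem_primes_in => /and3P[pp _ _]; rewrite prime_gt0 ?bal01.
have s3 := bernl_defect K x (Hl s w y) (Hl s' w y).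
have s4 := @blk_mono s s' w y x s'0 ss'.
lra.
Qed.
End ZeroOneLaw.

(** * Averaging over the pattern *)

(** Prepend to the shifted terms [L + c_i] the product [L] of all [c_i]: the new differences are
    terms of [c] or old differences, and these divide [L]. *)
Lemma gcd_difference_sequence k : exists c : nat -> nat,
  (forall i, (i < k)%N -> (0 < c i)%N) /\
  (forall i j, (i < j)%N -> (j < k)%N -> (c i < c j)%N && (c j - c i %| c i)%N).
Proof.
elim: k => [|k [c [c0 cd]]]; first by exists id; split=> // i j _; rewrite ltn0.
pose L := (\prod_(i < k) c i)%N.
have cL i : (i < k)%N -> (c i %| L)%N.
  by move=> ik; rewrite /L (bigD1 (Ordinal ik)) //= dvdn_mulr.
exists (fun i => if i is i'.+1 then L + c i' else L)%N; split.
  have L0 : (0 < L)%N by apply: prodn_cond_gt0 => i _; apply: c0.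
  by case=> [_|i ik] //; rewrite addn_gt0 L0.
case=> [|i] [|j] // ij jk.
  rewrite addKn cL // andbT -[ltnLHS]addn0 ltn_add2l; exact: c0.
have /andP[h1 h2] := cd i j ij jk.
rewrite ltn_add2l h1 subnDl dvdn_addr // (dvdn_trans h2) // cL //.
exact: (ltn_trans (ij : (i < j)%N) jk).
Qed.

Section Averages.
Context (R : realType) (delta : R) (rho : nat -> nat -> R).
Hypothesis K : dilation_kernel delta rho.
Notation nrm v := (ip rho v v).

(** Dilating the first pair by [B'] and the second by [B] makes them equal, so only the ratio of the
    arguments matters. *)
Lemma kernel_cross A B A' B' : (0 < B)%N -> (0 < B')%N ->
  (A * B' = B * A')%N -> rho A B = rho A' B'.
Proof.
move=> B0 B0' e.
by rewrite -(kernel_dil K A B B0') ![(B' * _)%N]mulnC e (kernel_dil K).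
Qed.

Lemma nrm_sum (v : nat -> {poly R}) k :
  nrm (\sum_(0 <= j < k) v j) = \sum_(0 <= j < k) nrm (v j) +
    2 * \sum_(0 <= j < k) \sum_(0 <= i < j) ip rho (v j) (v i).
Proof.
elim: k => [|k IH]; first by rewrite !big_geq // (ip0l rho); ring.
rewrite !big_nat_recr //= ipDl !(ipDr K) IH (ipC K _ (v k)) (ip_sumr K).
by ring.
Qed.

Lemma nrmX : nrm 'X = delta.
Proof. by rewrite -['X]expr1 ipXn (kernel_diag K). Qed.

Variables (w y : nat) (s : R).
Hypothesis s0 : 0 < s.

Let l := primes_in w y.
Let P := pprod w y.
Let Z := Zwt s l.
Let B := bernl (bal s) l.
Let F r := nrm (dil (r ^ 2) (B 'X) - B (B 'X)).

Let l_gt0 : {in l, forall p, (0 < p)%N}.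
Proof. by move=> p; rewrite mem_primes_in => /and3P[/prime_gt0]. Qed.

Let l_bal : {in l, forall p, (0 < p)%N /\ 0 <= bal s p <= 1}.
Proof. by move=> p /l_gt0 p0; rewrite p0 bal01. Qed.

Let Z_gt0 : 0 < Z. Proof. exact: Zwt_gt0. Qed.

Let B_expand v : \sum_(r <- divisors P) wt s r *: dil (r ^ 2) v = Z *: B v.
Proof.
rewrite /B bernl_expand ?primes_in_prime ?primes_in_uniq //.
by rewrite scalerA divff ?scale1r // gt_eqF.
Qed.

Let sum_wt : \sum_(r <- divisors P) wt s r = Z.
Proof. by rewrite sum_divisors_wt ?primes_in_prime ?primes_in_uniq. Qed.

(** Mean of squares minus square of the mean: with [h = B 'X], the vector [B h] is the weighted mean
    of the [dil (r ^ 2) h], all of the same norm as [h]. *)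
Lemma variance_identity :
  \sum_(r <- divisors P) wt s r * F r = Z * (nrm (B 'X) - nrm (B (B 'X))).
Proof.
set h := B 'X.
have P0 : (0 < P)%N := pprod_gt0 w y.
have e : \sum_(r <- divisors P) wt s r * F r = \sum_(r <- divisors P)
    (wt s r * (nrm h + nrm (B h)) - 2 * ip rho (wt s r *: dil (r ^ 2) h) (B h)).
  rewrite big_seq [RHS]big_seq; apply: eq_bigr => r; rewrite -dvdn_divisors // => rP.
  rewrite /F -/h !(ipBl, ipBr K) (nrm_dil K) ?expn_gt0 ?(dvdn_gt0 P0 rP) //.
  rewrite ipZl (ipC K (B h)); ring.
rewrite e sumrB -mulr_suml sum_wt -mulr_sumr -ip_suml B_expand ipZl; ring.
Qed.

(** With [g = gcdn n P] and [m = (n / g) r], the ratio of [n^2 + n] to [m^2] is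
    [(n+1) g^2 / (n r^2)], and summing over [r] assembles [B]. The free factor [d] turns [n] and
    [n + 1] into the integers of the pattern. *)
Lemma rough_average n d : (0 < n)%N -> (0 < d)%N ->
  \sum_(r <- divisors P) wt s r * rho (n ^ 2 + n) ((n %/ gcdn n P * r) ^ 2) =
  Z * ip rho (dil (d * n.+1) (dil ((gcdn n P) ^ 2) 'X)) (dil (d * n) (B 'X)).
Proof.
move=> n0 d0; have P0 : (0 < P)%N := pprod_gt0 w y.
rewrite -(ipZr K) -dilZ -B_expand dil_sum (ip_sumr K).
rewrite big_seq [RHS]big_seq; apply: eq_bigr => r; rewrite -dvdn_divisors // => rP.
have r0 := dvdn_gt0 P0 rP.
rewrite dilZ (ipZr K) -['X]expr1 !dilXn !muln1 ipXn; congr (_ * _).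
have g0 : (0 < gcdn n P)%N by rewrite gcdn_gt0 n0.
have ng := divnK (dvdn_gcdl n P).
apply: kernel_cross.
- by rewrite expn_gt0 muln_gt0 r0 divn_gt0 // dvdn_leq ?dvdn_gcdl.
- by rewrite !muln_gt0 d0 n0 ?expn_gt0 r0.
- move: ng; set g := gcdn n P; set q := (n %/ g)%N => ng.
  have -> : ((q * r) ^ 2 * (d * n.+1 * g ^ 2) = (q * g) ^ 2 * r ^ 2 * (d * n.+1))%N.
    by rewrite !expnMn; nia.
  rewrite ng; nia.
Qed.

(** The error [u] is paired with a vector in the range of the averaging, so by adjunction only [B u]
    counts, and [|B u|^2 = F r]; the term [eta / 2] comes from [nrm 'X <= 1]. *)
Lemma replace_by_average (eta : R) r x x' : 0 < eta -> (0 < r)%N ->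
  (0 < x)%N -> (0 < x')%N ->
  ip rho (dil x' (B 'X)) (dil x (B 'X)) - (eta / 2 + F r / (2 * eta)) <=
  ip rho (dil x' (dil (r ^ 2) 'X)) (dil x (B 'X)).
Proof.
move=> e0 r0 x0 x0'.
set u := dil x' (dil (r ^ 2) 'X - B 'X).
have -> : dil x' (dil (r ^ 2) 'X) = dil x' (B 'X) + u.
  by rewrite -dilD addrC subrK.
rewrite ipDl lerD2l dil_bernl (ip_bernl_adj K) //.
have Q0 : (0 < \prod_(p <- l) p)%N := pprod_gt0 w y.
apply: le_trans (ip_lower K _ _ e0).
rewrite lerN2 (nrm_bernl_adj K) // !(nrm_dil K) ?expn_gt0 ?Q0 //.
rewrite lerD //.
  rewrite ler_piMr ?divr_ge0 ?(ltW e0) //.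
  by rewrite nrmX -(kernel_diag K) (kernel_le1 K).
have -> : bernl (bal s) l u = dil x' (dil (r ^ 2) (B 'X) - B (B 'X)).
  by rewrite /u -dil_bernl bernlB dil_bernl.
by rewrite (nrm_dil K).
Qed.

(** By its mean the sum of the [k] vectors has energy at least [(k delta)^2], while the diagonal
    contributes at most [k delta]. *)
Lemma gram_lower k (x : nat -> nat) : 0 <= delta -> 2 <= k%:R * delta ->
  (forall i, (i < k)%N -> (0 < x i)%N) ->
  1 <= \sum_(0 <= j < k) \sum_(0 <= i < j)
         ip rho (dil (x j) (B 'X)) (dil (x i) (B 'X)).
Proof.
move=> d0 kd x0; pose v i := dil (x i) (B 'X).
have := @ip_mean _ _ _ K (\sum_(0 <= j < k) v j).
have hv c : (forall n, (0 < n)%N -> c ^+ n = c) ->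
    (\sum_(0 <= j < k) v j).[c] = k%:R * c.
  move=> hc; rewrite horner_sum (eq_big_nat _ _ (F2 := fun=> c)).
    by rewrite sumr_const_nat subn0 mulr_natl.
  move=> i /andP[_ ik]; rewrite /v horner_dil hc ?x0 // /B horner_bernl //.
  by rewrite hornerX.
rewrite !hv; first last.
- by move=> n n0; rewrite expr0n gtn_eqF.
- by move=> n _; rewrite expr1n.
rewrite mulr0 => /(_ erefl); rewrite nrm_sum -/v.
have h : \sum_(0 <= j < k) nrm (v j) <= k%:R * delta.
  rewrite big_nat; apply: (@le_trans _ _ (\sum_(0 <= j < k) delta)); last first.
    by rewrite sumr_const_nat subn0 mulr_natl.
  rewrite [leRHS]big_nat; apply: ler_sum => j /andP[_ jk].
  rewrite /v (nrm_dil K) ?x0 // -nrmX; exact: (nrm_bernl_le K).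
set S := \sum_(0 <= j < k) \sum_(0 <= i < j) _.
rewrite mulr1 => H; have : (k%:R * delta) * (k%:R * delta) >= 2 * (k%:R * delta).
  by rewrite ler_wpM2r //; lra.
have <- : delta ^+ 2 * k%:R ^+ 2 = (k%:R * delta) * (k%:R * delta) by ring.
lra.
Qed.

Section PatternSum.
Variables (M d c T : nat).
Hypotheses (d0 : (0 < d)%N) (dM : (d %| M)%N) (dc : (d %| c)%N).
Hypotheses (c0 : (0 < c)%N) (cM : (c <= M)%N).

Let nt t := ((t * M + c) %/ d)%N.

Lemma pattern_mul t : (d * nt t)%N = (t * M + c)%N.
Proof. by rewrite mulnC divnK // dvdn_add // dvdn_mull. Qed.

Lemma pattern_gt0 t : (0 < nt t)%N.
Proof. by have := pattern_mul t; case: (nt t) => //; lia. Qed.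

Lemma pattern_le t : (0 < t)%N -> (nt t <= 2 * M * t)%N.
Proof.
move=> t0; apply: (@leq_trans (d * nt t)); first by rewrite leq_pmull.
rewrite pattern_mul; nia.
Qed.

(** [nt] is injective and [nt t <= 2 M t], so passing from [1/t] to [1/n] costs a factor [2 M]. *)
Lemma sum_pattern_le (g : nat -> R) : (forall n, 0 <= g n) ->
  \sum_(1 <= t < T.+1) t%:R^-1 * g (nt t) <=
  (2 * M)%:R * \sum_(1 <= n < (2 * M * T).+1) n%:R^-1 * g n.
Proof.
move=> g0.
apply: (@le_trans _ _ (\sum_(1 <= t < T.+1) (2 * M)%:R * ((nt t)%:R^-1 * g (nt t)))).
  rewrite big_nat [leRHS]big_nat; apply: ler_sum => t /andP[t0 _].
  rewrite mulrA ler_wpM2r // ler_pdivlMr ?ltr0n ?pattern_gt0 //.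
  by rewrite mulrC ler_pdivrMr ?ltr0n // -natrM ler_nat pattern_le.
rewrite -mulr_sumr ler_wpM2l //.
apply: (@ler_sum_inj _ _ _ _ _ nt (fun n => n%:R^-1 * g n)).
- exact: iota_uniq.
- move=> t t' _ _ e; have := pattern_mul t; rewrite e pattern_mul; nia.
- move=> t; rewrite !mem_index_iota !ltnS pattern_gt0 => /andP[t0 tT] /=.
  by apply: leq_trans (pattern_le t0) _; rewrite leq_mul2l tT orbT.
- by move=> n; rewrite mulr_ge0 ?invr_ge0.
Qed.
End PatternSum.

Variables (N : nat).
Let S := (w ^ 2 * pprod 0 w)%N.
Let cor n := \sum_(1 <= m < N.+1) m%:R^-1 * rho (n ^ 2 + n) (m ^ 2).
(** The sum of [rough_average], cut to those [r] whose [m] is at most [N]. *)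
Let inner n := \sum_(r <- divisors P | (n %/ gcdn n P * r <= N)%N)
  wt s r * rho (n ^ 2 + n) ((n %/ gcdn n P * r) ^ 2).
Let g n := if sqlight w n then inner n else 0.

Hypotheses (w0 : (0 < w)%N) (wy : (w <= y)%N).

Let inner_ge0 n : 0 <= inner n.
Proof. by apply: sumr_ge0 => r _; rewrite mulr_ge0 ?wt_ge0 ?(kernel_ge0 K). Qed.

Let g_ge0 n : 0 <= g n. Proof. by rewrite /g; case: ifP. Qed.

(** The map from [r] to [m = q r] is injective, and [q <= S] bounds [1/r] by [S/m]. *)
Let inner_le n : (0 < n)%N -> (n <= y)%N -> sqlight w n ->
  inner n <= S%:R * cor n.
Proof.
move=> n0 ny gn; have P0 : (0 < P)%N := pprod_gt0 w y.
set q := (n %/ gcdn n P)%N.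
have q0 : (0 < q)%N by rewrite divn_gt0 ?gcdn_gt0 ?n0 // dvdn_leq ?dvdn_gcdl.
have qS : (q <= S)%N by apply: smooth_part_le.
rewrite /inner -big_filter -/q.
apply: (@le_trans _ _ (\sum_(r <- [seq r <- divisors P | (q * r <= N)%N])
    S%:R * ((q * r)%:R^-1 * rho (n ^ 2 + n) ((q * r) ^ 2)))).
  rewrite big_seq [leRHS]big_seq; apply: ler_sum => r.
  rewrite mem_filter -dvdn_divisors // => /andP[_ rP].
  have r0 := dvdn_gt0 P0 rP.
  rewrite mulrA ler_wpM2r ?(kernel_ge0 K) //.
  apply: le_trans (wt_le_inv r0 (ltW s0)) _.
  rewrite natrM invfM mulrA ler_peMl ?invr_ge0 //.
  by rewrite ler_pdivlMr ?ltr0n // mul1r ler_nat.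
rewrite -mulr_sumr ler_wpM2l //.
apply: (@ler_sum_inj _ _ _ _ _ (muln q) (fun m => m%:R^-1 * rho (n ^ 2 + n) (m ^ 2))).
- exact/filter_uniq/divisors_uniq.
- by move=> r r' _ _ /eqP; rewrite eqn_pmul2l // => /eqP.
- move=> r; rewrite mem_filter -dvdn_divisors // => /andP[qr rP].
  by rewrite mem_index_iota ltnS qr muln_gt0 q0 (dvdn_gt0 P0 rP).
- by move=> m; rewrite mulr_ge0 ?invr_ge0 ?(kernel_ge0 K).
Qed.

Section OnePair.
Variables (M d c T : nat) (eta tau : R).
Hypotheses (d0 : (0 < d)%N) (dM : (d %| M)%N) (dc : (d %| c)%N).
Hypotheses (c0 : (0 < c)%N) (cM : (c <= M)%N).
Hypotheses (Ty : (2 * M * T <= y)%N) (TN : (2 * M * T <= N)%N).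

Let nt t := ((t * M + c) %/ d)%N.
Let X := (2 * M * T)%N.
Let I t := ip rho (dil (t * M + (c + d)) (B 'X)) (dil (t * M + c) (B 'X)).

Lemma pair_upper :
  \sum_(1 <= t < T.+1) t%:R^-1 * g (nt t) <=
  (2 * M * S)%:R * \sum_(1 <= n < N.+1) n%:R^-1 * cor n.
Proof.
apply: le_trans (sum_pattern_le T d0 dM dc c0 cM g_ge0) _.
rewrite (natrM _ (2 * M) S) -mulrA ler_wpM2l // mulr_sumr.
have cor0 n : 0 <= cor n.
  by apply: sumr_ge0 => m _; rewrite mulr_ge0 ?invr_ge0 ?(kernel_ge0 K).
apply: (@le_trans _ _ (\sum_(1 <= n < (2 * M * T).+1) S%:R * (n%:R^-1 * cor n))).
  rewrite big_nat [leRHS]big_nat; apply: ler_sum => n /andP[n0 nX].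
  rewrite mulrCA ler_wpM2l ?invr_ge0 // /g; case: ifP => gn.
    by apply: inner_le => //; apply: leq_trans Ty.
  by rewrite mulr_ge0.
apply: ler_sum_nat_iota => // n; by rewrite !mulr_ge0 ?invr_ge0.
Qed.

Hypotheses (eta0 : 0 < eta) (tau0 : 0 <= tau).
Hypothesis sX : s * ln X%:R <= 1.
Hypothesis tail : \sum_(r <- divisors P | (N < S * r)%N) wt s r <= tau * Z.

Let I_le1 t : I t <= 1.
Proof.
rewrite /I; set u := dil _ _; set v := dil _ _.
have := nrm_ge0 K (u - v); rewrite !(ipBl, ipBr K) (ipC K v u).
have h x : (0 < x)%N -> nrm (dil x (B 'X)) <= 1.
  move=> x0; rewrite (nrm_dil K) //; apply: le_trans (nrm_bernl_le K _ l_bal) _.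
  by rewrite nrmX -(kernel_diag K) (kernel_le1 K).
have : nrm u <= 1 by apply: h; lia.
have : nrm v <= 1 by apply: h; lia.
lra.
Qed.

(** Combines [rough_average] with [replace_by_average]; the terms with [m > N] have [N < S r] and
    are covered by [tail]. *)
Let good_term t : (0 < t <= T)%N -> sqlight w (nt t) ->
  Z * (I t - (eta / 2 + tau) - F (gcdn (nt t) P) / (2 * eta)) <= inner (nt t).
Proof.
move=> /andP[t0 tT] gt; set n := nt t.
have n0 : (0 < n)%N by apply: pattern_gt0.
have ny : (n <= y)%N.
  apply: leq_trans Ty; apply: leq_trans (pattern_le d0 dM dc c0 cM t0) _.
  by rewrite leq_mul2l tT orbT.
have dn : (d * n = t * M + c)%N by apply: pattern_mul.
have dn1 : (d * n.+1 = t * M + (c + d))%N by rewrite mulnS dn; lia.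
have := rough_average n0 d0; rewrite dn dn1.
have g0 : (0 < gcdn n P)%N by rewrite gcdn_gt0 n0.
have x0 : (0 < t * M + c)%N by lia.
have x0' : (0 < t * M + (c + d))%N by lia.
have h1 := replace_by_average eta0 g0 x0 x0'; rewrite -/(I t) in h1 => e.
rewrite (bigID (fun r => (n %/ gcdn n P * r <= N)%N)) /= -/(inner n) in e.
have h2 : \sum_(r <- divisors P | ~~ (n %/ gcdn n P * r <= N)%N)
    wt s r * rho (n ^ 2 + n) ((n %/ gcdn n P * r) ^ 2) <= tau * Z.
  apply: le_trans tail; rewrite big_mkcond [leRHS]big_mkcond.
  apply: ler_sum => r _; rewrite -ltnNge.
  case: ifP => h; last by case: ifP => //; rewrite wt_ge0.
  rewrite (leq_trans h); last by rewrite leq_mul2r smooth_part_le ?orbT.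
  by rewrite ler_piMr ?wt_ge0 ?(kernel_le1 K).
have h3 := ler_wpM2l (ltW Z_gt0) h1.
rewrite -e in h3; move: h2 h3; lra.
Qed.

(** The losses are, in order: the [t] with [nt t] not [sqlight], the fixed errors of [good_term],
    and the mean of [F], which [sum_sqlight_le] and [variance_identity] turn into an energy drop. *)
Lemma pair_lower :
  Z * (\sum_(1 <= t < T.+1) t%:R^-1 * I t
     - ((2 * M)%:R * (w%:R^-1 * harm X) + harm T * (eta / 2 + tau)
        + M%:R * expR 1 * (1 + s^-1) * (nrm (B 'X) - nrm (B (B 'X))) / eta)) <=
  \sum_(1 <= t < T.+1) t%:R^-1 * g (nt t).
Proof.
pose Fg n := if sqlight w n then F (gcdn n P) else 0.
pose bad n : R := if sqlight w n then 0 else 1.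
have F0 r : 0 <= F r by apply: nrm_ge0 K _.
have hF : \sum_(1 <= t < T.+1) t%:R^-1 * Fg (nt t) <= (2 * M)%:R *
    (expR 1 * ((1 + s^-1) * (nrm (B 'X) - nrm (B (B 'X))))).
  apply: le_trans (sum_pattern_le T d0 dM dc c0 cM _) _.
    by move=> n; rewrite /Fg; case: ifP.
  rewrite ler_wpM2l //.
  have -> : nrm (B 'X) - nrm (B (B 'X)) = Z^-1 * \sum_(r <- divisors P) wt s r * F r.
    by rewrite variance_identity mulrA mulVf ?mul1r // gt_eqF.
  apply: le_trans (ler_wpM2l (expR_ge0 1) (sum_sqlight_le s0 wy Ty F0)).
  rewrite mulr_sumr [leRHS]big_mkcond [leLHS]big_nat [leRHS]big_nat; apply: ler_sum.
  move=> n /andP[n0 nX]; rewrite /Fg; case: ifP => gn; last by rewrite mulr0.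
  rewrite mulrA ler_wpM2r // wt_ge //; apply: le_trans sX; apply: ler_wpM2l; first exact: ltW.
  by rewrite ler_ln ?posrE ?ltr0n ?ler_nat // (leq_trans n0).
have hb : \sum_(1 <= t < T.+1) t%:R^-1 * bad (nt t) <= (2 * M)%:R * (w%:R^-1 * harm X).
  apply: le_trans (sum_pattern_le T d0 dM dc c0 cM _) _.
    by move=> n; rewrite /bad; case: ifP.
  rewrite ler_wpM2l //; apply: le_trans (harm_sqheavy_le _ w0).
  rewrite [leRHS]big_mkcond; apply: ler_sum => n _; rewrite /bad.
  by case: ifP => _; rewrite ?mulr0 ?mulr1.
have main : \sum_(1 <= t < T.+1) t%:R^-1 * (Z * (I t - (eta / 2 + tau)
      - Fg (nt t) / (2 * eta) - bad (nt t))) <=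
    \sum_(1 <= t < T.+1) t%:R^-1 * g (nt t).
  rewrite big_nat [leRHS]big_nat; apply: ler_sum => t /andP[t0 tT].
  rewrite ler_wpM2l ?invr_ge0 // /Fg /bad /g; case: ifP => gn.
    by rewrite subr0 good_term // t0.
  (* Here [g] vanishes, and the unit subtracted for a bad [t] makes the left side nonpositive
     because [I t <= 1]. *)
  have := I_le1 t; rewrite mul0r subr0 => h.
  by rewrite pmulr_rle0 //; move: h eta0 tau0; lra.
apply: le_trans main.
have -> : \sum_(1 <= t < T.+1) t%:R^-1 * (Z * (I t - (eta / 2 + tau)
      - Fg (nt t) / (2 * eta) - bad (nt t))) =
  Z * (\sum_(1 <= t < T.+1) t%:R^-1 * I t - harm T * (eta / 2 + tau) -
    (\sum_(1 <= t < T.+1) t%:R^-1 * Fg (nt t)) / (2 * eta) -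
    \sum_(1 <= t < T.+1) t%:R^-1 * bad (nt t)).
  rewrite /harm !mulr_suml -!sumrB mulr_sumr; apply: eq_bigr => t _; ring.
rewrite ler_pM2l // !opprD !addrA.
have : (\sum_(1 <= t < T.+1) t%:R^-1 * Fg (nt t)) / (2 * eta) <=
   M%:R * expR 1 * (1 + s^-1) * (nrm (B 'X) - nrm (B (B 'X))) / eta.
  rewrite ler_pdivrMr; last by move: eta0; lra.
  apply: le_trans hF _; rewrite natrM le_eqVlt; apply/orP; left; apply/eqP.
  by field; rewrite !gt_eqF.
lra.
Qed.
End OnePair.

(** At each [t] the correlations over [i < j] sum to at least 1 by [gram_lower]; every pair obeys
    [pair_lower] and [pair_upper], and [k ^ 2] overcounts the pairs. *)
Lemma all_pairs_bound k (c : nat -> nat) M T (eta tau : R) :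
  0 <= delta -> 2 <= k%:R * delta ->
  (forall i, (i < k)%N -> (0 < c i <= M)%N && (c i %| M)%N) ->
  (forall i j, (i < j)%N -> (j < k)%N -> (c i < c j)%N && (c j - c i %| c i)%N) ->
  (2 * M * T <= y)%N -> (2 * M * T <= N)%N ->
  0 < eta -> 0 <= tau -> s * ln (2 * M * T)%:R <= 1 ->
  \sum_(r <- divisors P | (N < S * r)%N) wt s r <= tau * Z ->
  Z * harm T <= (k ^ 2)%:R * ((2 * M * S)%:R * \sum_(1 <= n < N.+1) n%:R^-1 * cor n
    + Z * ((2 * M)%:R * (w%:R^-1 * harm (2 * M * T)) + harm T * (eta / 2 + tau)
      + M%:R * expR 1 * (1 + s^-1) * (nrm (B 'X) - nrm (B (B 'X))) / eta)).
Proof.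
move=> de0 kd cM cd Ty TN eta0 tau0 sX tail.
set A := _%:R * \sum_(_ <= n < _) _; set E := _ + _ + _.
have A0 : 0 <= A.
  rewrite mulr_ge0 //; apply: sumr_ge0 => n _; rewrite mulr_ge0 ?invr_ge0 //.
  by apply: sumr_ge0 => m _; rewrite mulr_ge0 ?invr_ge0 ?(kernel_ge0 K).
have E0 : 0 <= E.
  have V0 : 0 <= nrm (B 'X) - nrm (B (B 'X)).
    by rewrite subr_ge0; apply: (nrm_bernl_le K).
  apply: addr_ge0; first apply: addr_ge0.
  - by rewrite !mulr_ge0 ?invr_ge0 ?harm_ge0.
  - by rewrite mulr_ge0 ?harm_ge0 // addr_ge0 // divr_ge0 // ltW.
  - apply: divr_ge0; last exact: ltW.
    apply: mulr_ge0 V0; rewrite !mulr_ge0 ?expR_ge0 //.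
    by rewrite addr_ge0 // invr_ge0 ltW.
pose I i j t := ip rho (dil (t * M + c j) (B 'X)) (dil (t * M + c i) (B 'X)).
have hI i j : (i < j)%N -> (j < k)%N ->
    Z * \sum_(1 <= t < T.+1) t%:R^-1 * I i j t <= A + Z * E.
  move=> ij jk; have ik := ltn_trans ij jk.
  have /andP[/andP[ci0 ciM] cidM] := cM i ik; have /andP[cij dvd] := cd i j ij jk.
  have d0 : (0 < c j - c i)%N by rewrite subn_gt0.
  have dM := dvdn_trans dvd cidM.
  have := le_trans (pair_lower d0 dM dvd ci0 ciM Ty TN eta0 tau0 sX tail)
    (pair_upper d0 dM dvd ci0 ciM Ty TN).
  by rewrite subnKC 1?ltnW // -/(I i j) mulrBr -/A -/E lerBlDr.
have h1 : harm T <= \sum_(0 <= j < k) \sum_(0 <= i < j)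
    \sum_(1 <= t < T.+1) t%:R^-1 * I i j t.
  under eq_bigr do rewrite exchange_big /=.
  rewrite exchange_big /= /harm; apply: ler_sum => t _.
  under eq_bigr do rewrite -mulr_sumr.
  rewrite -mulr_sumr ler_peMr ?invr_ge0 //.
  apply: (@gram_lower k (fun i => t * M + c i)%N) => // i ik.
  by have /andP[/andP[ci0 _] _] := cM i ik; rewrite addn_gt0 ci0 orbT.
apply: le_trans (ler_wpM2l (ltW Z_gt0) h1) _.
rewrite mulr_sumr.
have h2 : \sum_(0 <= j < k) (k%:R * (A + Z * E)) = (k ^ 2)%:R * (A + Z * E).
  by rewrite sumr_const_nat subn0 -[LHS]mulr_natl mulrA -natrM mulnn.
rewrite -h2 big_nat [leRHS]big_nat; apply: ler_sum => j /andP[_ jk].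
rewrite mulr_sumr; apply: (@le_trans _ _ (\sum_(0 <= i < j) (A + Z * E))).
  by rewrite big_nat [leRHS]big_nat; apply: ler_sum => i /andP[_ ij]; apply: hI.
rewrite sumr_const_nat subn0 -[leLHS]mulr_natl ler_wpM2r ?ler_nat ?(ltnW jk) //.
by rewrite addr_ge0 // mulr_ge0 // ltW.
Qed.

End Averages.

(** * Choice of the parameters *)

Section Quantitative.
Context (R : realType) (delta : R) (rho : nat -> nat -> R).
Hypothesis K : dilation_kernel delta rho.

Lemma ln_nat_ge (b : R) : exists N0, forall N, (N0 <= N)%N -> b <= ln N%:R.
Proof.
exists (Num.truncn (expR b)).+1 => N hN.
have h : expR b <= N%:R.
  by apply: ltW; apply: lt_le_trans (truncnS_gt _) _; rewrite ler_nat.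
by rewrite -[b]expRK ler_ln ?posrE ?expR_gt0 // (lt_le_trans _ h) ?expR_gt0.
Qed.

(** Rankin's bound at [Y = N / S]: the factor [1 + 2/s <= 3/s] is at most [6 D Z], and the last
    hypothesis makes [Y^-(s/2)] at most [tau / (6 D)]. *)
Lemma tail_le (s : R) w N S (D tau : R) : let Z := Zwt s (primes_in w N) in
  0 < s -> s <= 1 -> (0 < S)%N -> (0 < N)%N -> 0 < D -> 0 < tau ->
  (2 * s)^-1 <= D * Z ->
  ln (6 * D / tau) <= s / 2 * (ln N%:R - ln S%:R) ->
  \sum_(r <- divisors (pprod w N) | (N < S * r)%N) wt s r <= tau * Z.
Proof.
move=> Z s0 s1 S0 N0 D0 tau0 hZ hln.
have Y0 : 0 < N%:R / S%:R :> R by rewrite divr_gt0 ?ltr0n.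
rewrite (eq_bigl (fun r => N%:R / S%:R < r%:R :> R)); last first.
  by move=> r; rewrite ltr_pdivrMr ?ltr0n // -natrM ltr_nat mulnC.
apply: le_trans (sum_divisors_wt_tail s0 (pprod_gt0 w N) Y0) _.
have h1 : 1 + 2 / s <= 3 / s.
  have -> : 3 / s = 1 / s + 2 / s by field; rewrite gt_eqF.
  by rewrite lerD2r ler_pdivlMr // mul1r.
have h2 : (N%:R / S%:R) `^ (- (s / 2)) <= tau / (6 * D).
  rewrite /powR gt_eqF // lnM ?posrE ?invr_gt0 ?ltr0n // lnV ?posrE ?ltr0n //.
  have -> : tau / (6 * D) = expR (- ln (6 * D / tau)).
    by rewrite expRN lnK ?posrE ?invf_div // divr_gt0 // mulr_gt0.
  by rewrite ler_expR mulNr lerN2.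
apply: (@le_trans _ _ (tau / (6 * D) * (3 / s))).
  apply: ler_pM; rewrite ?powR_ge0 //.
  by rewrite addr_ge0 // divr_ge0 // ltW.
have -> : tau / (6 * D) * (3 / s) = tau * (D^-1 * (2 * s)^-1).
  by field; rewrite !gt_eqF.
by rewrite ler_pM2l // ler_pdivrMl.
Qed.

(** With [y = N], the losses in [all_pairs_bound] absorb at most half of [Z * harm T], and both
    factors are bounded below by multiples of [ln N]. *)
Lemma correlation_lower : 0 < delta -> exists c0 N0, 0 < c0 /\
  forall N, (N0 <= N)%N -> c0 * ln N%:R ^+ 2 <=
    \sum_(1 <= n < N.+1) n%:R^-1 *
      \sum_(1 <= m < N.+1) m%:R^-1 * rho (n ^ 2 + n) (m ^ 2).
Proof.
move=> delta0.
pose k := (Num.truncn (2 / delta)).+1.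
have kd : 2 <= k%:R * delta.
  by rewrite -ler_pdivrMr //; apply/ltW/truncnS_gt.
have [c [c0 cd]] := gcd_difference_sequence k.
pose M := (\prod_(i < k) c i)%N.
have M0 : (0 < M)%N by apply: prodn_cond_gt0 => i _; apply: c0.
have cM i : (i < k)%N -> (0 < c i <= M)%N && (c i %| M)%N.
  move=> ik; have h : (c i %| M)%N by rewrite /M (bigD1 (Ordinal ik)) //= dvdn_mulr.
  by rewrite c0 // (dvdn_leq M0 h).
pose kk : R := (k ^ 2)%:R; pose m : R := M%:R; pose e : R := expR 1.
have kk0 : 0 < kk by rewrite ltr0n.
have m0 : 0 < m by rewrite ltr0n.
have e0 : 0 < e by apply: expR_gt0.
(* Chosen so that [kk * (eta / 2 + tau) = 1/4]. *)
pose eta := (4 * kk)^-1; pose tau := (8 * kk)^-1.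
have eta0 : 0 < eta by rewrite invr_gt0; lra.
have tau0 : 0 < tau by rewrite invr_gt0; lra.
(* Limits the cost of the energy drop to [harm T / 8]; the bound [64 * kk * m] on [w] does the same
   for the bad [n]. *)
pose eps := eta / (32 * kk * m * e).
have eps0 : 0 < eps by rewrite divr_gt0 // !mulr_gt0.
have [w [y0 [s1 [w0w wy0 s10 zol]]]] :=
  zero_one_law K eps0 (Num.truncn (64 * kk * m)).+1.
have w0 : (0 < w)%N by apply: leq_trans w0w.
have hw : 64 * kk * m <= w%:R.
  by apply/ltW; apply: lt_le_trans (truncnS_gt _) _; rewrite ler_nat.
pose S := (w ^ 2 * pprod 0 w)%N.
have S0 : (0 < S)%N by rewrite muln_gt0 expn_gt0 w0 pprod_gt0.
pose D := e * 2 ^+ w.+1.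
have D0 : 0 < D by rewrite mulr_gt0 // exprn_gt0.
(* [C] will be [s * ln N]: [C >= 1] keeps [exp (1/s)] within [N], and the other bound controls the
   tail. *)
pose C := Num.max 1 (4 * ln (6 * D / tau)).
have C1 : 1 <= C by rewrite le_max lexx.
have Cl : ln (6 * D / tau) <= C / 4.
  have : 4 * ln (6 * D / tau) <= C by rewrite le_max lexx orbT.
  lra.
have C0 : 0 < C by lra.
(* The four thresholds give, in turn, [s <= 1], [s <= s1], [ln S <= L / 2] and
   [ln (2 M) <= 1 / (2 s)]. *)
pose b := Num.max C (Num.max (C / s1) (Num.max (2 * ln S%:R) (C * (2 * ln (2 * M)%:R)))).
have [N0 hN0] := ln_nat_ge b.
have M2 : 1 <= (2 * M)%:R :> R by rewrite ler1n muln_gt0 M0.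
exists (16 * C ^+ 2 * kk * m * S%:R * D)^-1, (maxn y0 N0); split.
  by rewrite invr_gt0 !mulr_gt0 ?exprn_gt0 ?ltr0n.
move=> N; rewrite geq_max => /andP[y0N N0N].
have := hN0 N N0N; rewrite !ge_max => /and4P[l1 l2 l3 l4].
set L := ln N%:R in l1 l2 l3 l4 *.
have {}l1 : C <= L by rewrite /C ge_max.
have L0 : 0 < L by lra.
have wN := leq_trans wy0 y0N.
have N_gt0 : (0 < N)%N := leq_trans w0 wN.
pose s := C / L.
have s0 : 0 < s by rewrite divr_gt0.
have sL : s^-1 = L / C by rewrite invf_div.
have ss1 : s <= s1 by rewrite ler_pdivrMr // mulrC -ler_pdivrMr.
have s1' : s <= 1 by rewrite ler_pdivrMr // mul1r.
have sl4 : 2 * ln (2 * M)%:R <= s^-1 by rewrite sL ler_pdivlMr // mulrC.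
have lnM0 : 0 <= ln (2 * M)%:R :> R by rewrite ln_ge0.
have si1 : 1 <= s^-1 by rewrite invf_ge1.
(* The longest range with [2 M T <= exp (1/s)], where the weights are comparable with [1/n]; its
   harmonic sum is still at least [1 / (2 s)]. *)
pose T := Num.truncn (expR s^-1 / (2 * M)%:R).
have q0 : 0 <= expR s^-1 / (2 * M)%:R :> R by rewrite divr_ge0 ?expR_ge0.
have /andP[T1 T2] := truncn_itv q0; rewrite -/T in T1 T2.
have M2p : 0 < (2 * M)%:R :> R by rewrite ltr0n muln_gt0 M0.
have XE : (2 * M * T)%:R <= expR s^-1 :> R.
  by rewrite natrM mulrC -ler_pdivlMr.
have HT : (2 * s)^-1 <= harm T.
  apply: le_trans (harm_ge T); apply: (@le_trans _ _ (s^-1 - ln (2 * M)%:R)).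
    rewrite invfM; lra.
  have -> : s^-1 - ln (2 * M)%:R = ln (expR s^-1 / (2 * M)%:R).
    by rewrite lnM ?posrE ?invr_gt0 ?expR_gt0 // lnV ?posrE // expRK.
  rewrite ler_ln ?posrE ?divr_gt0 ?expR_gt0 //; exact: ltW T2.
have T0 : (0 < T)%N.
  rewrite lt0n; apply/eqP => TE; move: HT; rewrite TE /harm big_geq // leNgt.
  by rewrite invr_gt0 mulr_gt0.
have X0 : (0 < 2 * M * T)%N by rewrite !muln_gt0 M0.
have lnX : ln (2 * M * T)%:R <= s^-1.
  by rewrite -[s^-1]expRK ler_ln ?posrE ?expR_gt0 ?ltr0n.
have sX : s * ln (2 * M * T)%:R <= 1 by rewrite mulrC -ler_pdivlMr // div1r.
have XN : (2 * M * T <= N)%N.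
  rewrite -(ler_nat R); apply: le_trans XE _.
  rewrite -[leRHS]lnK ?posrE ?ltr0n // ler_expR -/L sL ler_pdivrMr //.
  by rewrite ler_peMr // ltW.
have TX : (T <= 2 * M * T)%N by rewrite leq_pmull // muln_gt0.
have HX : harm (2 * M * T) <= 4 * harm T :> R.
  apply: (le_trans (harm_le X0)); rewrite invfM in HT; lra.
have sT : s * ln T%:R <= 1.
  apply: le_trans sX; rewrite ler_pM2l // ler_ln ?posrE ?ltr0n // ler_nat //.
have hZ := harm_le_Zwt wN (leq_trans TX XN) (ltW s0) sT.
set Z := Zwt s (primes_in w N) in hZ.
have Z0 : 0 < Z := Zwt_gt0 _ _.
have hZ2 : (2 * s)^-1 <= D * Z by apply: le_trans HT _.
have tl : \sum_(r <- divisors (pprod w N) | (N < S * r)%N) wt s r <= tau * Z.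
  apply: (tail_le s0 s1' S0 N_gt0 D0 tau0 hZ2); apply: le_trans Cl _.
  have -> : C / 4 = s / 2 * (L / 2) by rewrite /s; field; rewrite gt_eqF.
  by rewrite ler_pM2l ?divr_gt0 // -/L; lra.
have := all_pairs_bound K s0 w0 wN (ltW delta0) kd cM cd XN XN eta0 (ltW tau0) sX tl.
have := zol N s y0N s0 ss1.
set V := ip rho _ _ - _; move=> Ve.
set Ds := \sum_(1 <= n < N.+1) _; rewrite -/kk -/m -/e -/S -/Z => main.
have HT0 : 0 < harm T :> R by apply: lt_le_trans HT; rewrite invr_gt0 mulr_gt0.
have t1 : kk * ((2 * M)%:R * (w%:R^-1 * harm (2 * M * T))) <= harm T / 8.
  rewrite natrM -/m.
  have hw0 : 0 < w%:R :> R by rewrite ltr0n.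
  have -> : kk * (2%:R * m * (w%:R^-1 * harm (2 * M * T))) =
    (64 * kk * m) * harm (2 * M * T) / (32 * w%:R) by field; rewrite gt_eqF.
  rewrite ler_pdivrMr ?mulr_gt0 //.
  apply: (@le_trans _ _ (w%:R * (4 * harm T))); last lra.
  by apply: ler_pM; rewrite ?harm_ge0 // !mulr_ge0 ?ltW.
have t2 : kk * (harm T * (eta / 2 + tau)) = harm T / 4.
  by rewrite /eta /tau; field; rewrite gt_eqF.
have t3 : kk * (m * e * (1 + s^-1) * V / eta) <= harm T / 8.
  have -> : kk * (m * e * (1 + s^-1) * V / eta) =
     (kk * m * e * 32 / eta * V) * ((1 + s^-1) / 32) by field; rewrite !gt_eqF.
  have h1 : kk * m * e * 32 / eta * V <= 1.
    apply: (@le_trans _ _ (kk * m * e * 32 / eta * eps)).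
      by rewrite ler_wpM2l // divr_ge0 ?mulr_ge0 // ltW.
    rewrite /eps le_eqVlt; apply/orP; left; apply/eqP.
    by field; rewrite !gt_eqF.
  apply: le_trans (ler_wpM2r _ h1) _; first by lra.
  by rewrite invfM in HT; lra.
have half : Z * harm T / 2 <= kk * ((2 * M * S)%:R * Ds).
  have : kk * ((2 * M)%:R * (w%:R^-1 * harm (2 * M * T)) + harm T * (eta / 2 + tau)
     + m * e * (1 + s^-1) * V / eta) <= harm T / 2 by lra.
  move=> /(ler_wpM2l (ltW Z0)); lra.
have Ds1 : Z * harm T <= 4 * kk * m * S%:R * Ds.
  by move: half; rewrite !natrM -/m; lra.
rewrite mulrC ler_pdivrMr; last by rewrite !mulr_gt0 ?exprn_gt0 ?ltr0n.
(* [Z] (up to [D]) and [harm T] each supply a factor [1 / (2 s)], and [L] is [2 C] times this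
   factor. *)
have hh : (2 * s)^-1 * (2 * s)^-1 <= D * (Z * harm T).
  by rewrite mulrA; apply: ler_pM => //; rewrite invr_ge0 mulr_ge0 // ltW.
have -> : L ^+ 2 = 4 * C ^+ 2 * ((2 * s)^-1 * (2 * s)^-1).
  by rewrite /s; field; rewrite !gt_eqF.
have -> : Ds * (16 * C ^+ 2 * kk * m * S%:R * D) =
  4 * C ^+ 2 * (D * (4 * kk * m * S%:R * Ds)) by ring.
rewrite ler_wpM2l ?mulr_ge0 ?(ltW C0) //; apply: le_trans hh _.
by rewrite ler_wpM2l // ltW.
Qed.
End Quantitative.

(** * From the kernel to upper densities *)

Local Open Scope ereal_scope.

Theorem theorem1p8 (R : realType) (Phi : nat -> {fset nat}) (L : set nat)
  (hPhi : mult_Folner R Phi)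
  (hL : L `<=` [set n | (0 < n)%N])
  (hd : 0 < upper_density R Phi L) :
  0 < limn_einf (fun N : nat =>
        (((ln N%:R ^+ 2)^-1)%R : R)%:E *
        \sum_(1 <= m < N.+1) \sum_(1 <= n < N.+1)
          (((m * n)%:R^-1)%R : R)%:E *
          upper_density R Phi
            (inv_dilate (n ^ 2 + n)%N L `&` inv_dilate (m ^ 2)%N L)).
Proof.
have [delta [rho [delta0 K rho_le]]] := dilation_kernel_exists hPhi hL hd.
have [c0 [N0 [c0_gt0 H]]] := correlation_lower K delta0.
apply: (@lt_le_trans _ _ c0%:E); first by rewrite lte_fin.
rewrite /limn_einf; rewrite -[- limn_esup _]/(limf_einf _ \oo) limf_einfE.
set u := (fun N : nat => _ * _).
(* The limit inferior is at least the infimum over any tail; starting at 2 makes [ln N] positive. *)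
apply: (@le_trans _ _ (ereal_inf (u @` [set N | (maxn 2 N0 <= N)%N]))); last first.
  apply: ereal_sup_ubound.
  by exists [set N | (maxn 2 N0 <= N)%N] => //; exact: nbhs_infty_ge.
apply: le_ereal_inf_tmp => _ [N /= + <-]; rewrite geq_max => /andP[N2 NN].
have lN : (0 < ln N%:R :> R)%R by rewrite ln_gt0 // ltr1n.
apply: (@le_trans _ _ (((ln N%:R ^+ 2)^-1)%:E *
  (\sum_(1 <= m < N.+1) \sum_(1 <= n < N.+1)
    (m * n)%:R^-1 * rho (n ^ 2 + n)%N (m ^ 2)%N)%R%:E)); last first.
  rewrite /u lee_wpmul2l ?lee_fin ?invr_ge0 ?sqr_ge0 //.
  rewrite -sumEFin; apply: lee_sum => m _; rewrite -sumEFin; apply: lee_sum => n _.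
  by rewrite EFinM lee_wpmul2l ?lee_fin ?invr_ge0.
rewrite -EFinM lee_fin ler_pdivlMl ?exprn_gt0 // mulrC.
apply: le_trans (H N NN) _; rewrite exchange_big /=.
rewrite le_eqVlt; apply/orP; left; apply/eqP; apply: eq_bigr => n _.
by rewrite mulr_sumr; apply: eq_bigr => m _; rewrite natrM invfM mulrA [(n%:R^-1 * _)%R]mulrC.
Qed.
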